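(* Let $\Gamma$ be a vertex- and arc-transitive two-ended digraph, and let $G=\mathrm{Aut}(\Gamma)$. Then $G$ contains a normal subgroup $N$ having finite orbits on $V\Gamma$ such that either: (i) $\Gamma/N\cong\mathbb Z$ and $G/N\cong D_\infty$; or (ii) $\Gamma/N\cong\vec{\mathbb Z}$ and $G/N\cong\mathbb Z$. In particular, $\Gamma$ has Property Z in case (ii) but not in case (i). Moreover, if $\Gamma$ is $2$-arc-transitive, then (ii) holds. In case (i) $G$ acts transitively on the ends of $\Gamma$, but in case (ii) $G$ acts trivially on the ends of $\Gamma$.
   Context: A digraph $\Gamma=(V\Gamma,E\Gamma)$ has vertex set $V\Gamma$ and arc set $E\Gamma\subseteq V\Gamma\times V\Gamma$; both $(v,w)$ and $(w,v)$ may be arcs. It is connected if its underlying undirected graph is connected. $\Gamma$ is vertex-transitive (arc-transitive, 2-arc-transitive) if $\mathrm{Aut}(\Gamma)$ is transitive on vertices (arcs, 2-arcs), where a 2-arc is a sequence $v_0,v_1,v_2$ of vertices with $(v_0,v_1),(v_1,v_2)\in E\Gamma$. A ray is a one-way infinite path (in the underlying undirected graph) with distinct vertices. The ends of a digraph are the equivalence classes of rays, where two rays are equivalent if there is an infinite family of pairwise disjoint paths (ignoring directions) each having its initial vertex in one ray and terminal vertex in the other. A digraph is two-ended if it is connected and has exactly two ends. $\mathrm{Aut}(\Gamma)$ acts on the set of ends. The symbol $\mathbb Z$ denotes both the group of integers and the digraph with vertex set $\mathbb Z$ and arcs $(i,i+1)$ and $(i+1,i)$ for all $i\in\mathbb Z$;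 $\vec{\mathbb Z}$ is the digraph with vertex set $\mathbb Z$ and arcs $(i,i+1)$ for all $i\in\mathbb Z$. $D_\infty$ is the infinite dihedral group. For a subgroup $N\le\mathrm{Aut}(\Gamma)$, the quotient digraph $\Gamma/N$ has the $N$-orbits on $V\Gamma$ as vertices, and $(A,B)$ is an arc of $\Gamma/N$ iff there are $v\in A$, $w\in B$ with $(v,w)\in E\Gamma$. A connected digraph $\Gamma$ has Property Z if there is a surjective digraph homomorphism (a map on vertices sending arcs to arcs, preserving direction) $\Gamma\to\vec{\mathbb Z}$. *)

(* Defs.v *)
From HB Require Import structures.
From mathcomp Require Import all_boot all_algebra.
From mathcomp Require Import boolp classical_sets functions cardinality.

Set Implicit Arguments.
Unset Strict Implicit.
Unset Printing Implicit Defensive.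

Import GRing.Theory.

Local Open Scope classical_set_scope.
Local Open Scope group_scope.

(* MathComp's {group gT} and _ / _ need a finGroupType, and the groups here are
   infinite: the quotient is the set of left cosets g N under setwise product. *)

Record normalSubgroup (G : groupType) := NormalSubgroup {
  nsub_set :> set G;
  nsub_group : group_closed (mem nsub_set);
  nsub_normal : forall x g, nsub_set x -> nsub_set (x ^ g)
}.

Section QuotientGroup.
Variables (G : groupType) (N : normalSubgroup G).

Definition lcoset_set (g : G) : set G := [set g * n | n in N].

Definition cosets : set (set G) := range lcoset_set.

Lemma nsub1 : nsub_set N 1.
Proof. by have [+ _] := nsub_group N; rewrite inE. Qed.

Lemma nsubM x y : nsub_set N x -> nsub_set N y -> nsub_set N (x * y).
Proof.
move=> Nx Ny; have /group_closedM := nsub_group N.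
by move/(_ x y); rewrite !inE; apply.
Qed.

Lemma nsubV x : nsub_set N x -> nsub_set N x^-1.
Proof.
by move=> Nx; have /group_closedV/(_ x) := nsub_group N; rewrite !inE; apply.
Qed.

Lemma lcoset_setM x y :
  [set a * b | a in lcoset_set x & b in lcoset_set y] = lcoset_set (x * y).
Proof.
apply/seteqP; split => z /=.
  move=> [_ [m Nm <-]] [_ [n Nn <-]] <-.
  exists (m ^ y * n); first by apply: nsubM => //; apply: nsub_normal.
  by rewrite /conjg !mulgA mulgK.
move=> [n Nn <-]; exists x; first by exists 1; [exact: nsub1|rewrite mulg1].
by exists (y * n); [exists n|rewrite mulgA].
Qed.

Lemma lcoset_setV x : [set a^-1 | a in lcoset_set x] = lcoset_set x^-1.
Proof.
have conjV n y : nsub_set N n -> nsub_set N (y * (n * y^-1)).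
  by move=> /(nsub_normal y^-1); rewrite /conjg invgK.
apply/seteqP; split => z /=.
  move=> [_ [n Nn <-] <-]; exists (x * (n^-1 * x^-1)).
    exact/conjV/nsubV.
  by rewrite invgM mulKg.
move=> [n Nn <-]; exists (n^-1 * x); last by rewrite invgM invgK.
exists (x^-1 * (n^-1 * x)); last by rewrite mulVKg.
exact/nsub_normal/nsubV.
Qed.

Definition quotient_group : Type := set_type cosets.
HB.instance Definition _ := Choice.on quotient_group.

Lemma coset_mul_subproof (A B : quotient_group) :
  [set a * b | a in \val A & b in \val B] \in cosets.
Proof.
have [x _ <-] := set_mem (valP A); have [y _ <-] := set_mem (valP B).
by rewrite lcoset_setM; apply/mem_set; exists (x * y).
Qed.

Lemma coset_inv_subproof (A : quotient_group) :
  [set a^-1 | a in \val A] \in cosets.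
Proof.
have [x _ <-] := set_mem (valP A).
by rewrite lcoset_setV; apply/mem_set; exists x^-1.
Qed.

Definition coset (g : G) : quotient_group :=
  SigSub (mem_set (imageT lcoset_set g)).
Definition coset_mul (A B : quotient_group) : quotient_group :=
  SigSub (coset_mul_subproof A B).
Definition coset_inv (A : quotient_group) : quotient_group :=
  SigSub (coset_inv_subproof A).

Lemma cosetP (A : quotient_group) : exists g, A = coset g.
Proof.
by case: A => [A AN]; case: (set_mem AN) => x _ xA; exists x; apply/val_inj.
Qed.

Lemma coset_mulE x y : coset_mul (coset x) (coset y) = coset (x * y).
Proof. by apply/val_inj; rewrite /= lcoset_setM. Qed.

Lemma coset_invE x : coset_inv (coset x) = coset x^-1.
Proof. by apply/val_inj; rewrite /= lcoset_setV. Qed.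

Lemma coset_mulA : associative coset_mul.
Proof.
move=> A B C; have [x ->] := cosetP A; have [y ->] := cosetP B.
by have [z ->] := cosetP C; rewrite !coset_mulE mulgA.
Qed.

Lemma coset_mul1g : left_id (coset 1) coset_mul.
Proof. by move=> A; have [x ->] := cosetP A; rewrite coset_mulE mul1g. Qed.

Lemma coset_mulg1 : right_id (coset 1) coset_mul.
Proof. by move=> A; have [x ->] := cosetP A; rewrite coset_mulE mulg1. Qed.

Lemma coset_mulVg : left_inverse (coset 1) coset_inv coset_mul.
Proof.
by move=> A; have [x ->] := cosetP A; rewrite coset_invE coset_mulE mulVg.
Qed.

Lemma coset_mulgV : right_inverse (coset 1) coset_inv coset_mul.
Proof.
by move=> A; have [x ->] := cosetP A; rewrite coset_invE coset_mulE mulgV.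
Qed.

HB.instance Definition _ := isGroup.Build quotient_group
  coset_mulA coset_mul1g coset_mulg1 coset_mulVg coset_mulgV.

End QuotientGroup.

Definition group_isomorphic (G H : groupType) : Prop :=
  exists f : {multiplicative G -> H}, bijective f.

Definition infinite_cyclic : groupType := Algebra.to_multiplicative int.

(* The semidirect product of int by {1, -1}: the pair (m, s) stands for the
   isometry x |-> (-1)^s x + m of the integers. *)
Definition infinite_dihedral : Type := (int * bool)%type.
HB.instance Definition _ := Choice.on infinite_dihedral.

Section InfiniteDihedral.
Local Open Scope ring_scope.

Definition dihedral_one : infinite_dihedral := (0, false).
Definition dihedral_mul (x y : infinite_dihedral) : infinite_dihedral :=
  (x.1 + (-1) ^+ x.2 * y.1, x.2 (+) y.2).
Definition dihedral_inv (x : infinite_dihedral) : infinite_dihedral :=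
  (- ((-1) ^+ x.2 * x.1), x.2).

Lemma dihedral_mulA : associative dihedral_mul.
Proof.
move=> [a s] [b t] [c u]; rewrite /dihedral_mul /= addbA; congr pair.
by rewrite mulrDr addrA mulrA signr_addb.
Qed.

Lemma dihedral_mul1g : left_id dihedral_one dihedral_mul.
Proof. by move=> [a s]; rewrite /dihedral_mul /= add0r mul1r. Qed.

Lemma dihedral_mulg1 : right_id dihedral_one dihedral_mul.
Proof. by move=> [a s]; rewrite /dihedral_mul /= mulr0 addr0 addbF. Qed.

Lemma dihedral_mulVg : left_inverse dihedral_one dihedral_inv dihedral_mul.
Proof. by move=> [a s]; rewrite /dihedral_mul /= addNr addbb. Qed.

Lemma dihedral_mulgV : right_inverse dihedral_one dihedral_inv dihedral_mul.
Proof.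
move=> [a s]; rewrite /dihedral_mul /= mulrN mulrA -signr_addb addbb mul1r.
by rewrite subrr.
Qed.

HB.instance Definition _ := isGroup.Build infinite_dihedral
  dihedral_mulA dihedral_mul1g dihedral_mulg1 dihedral_mulVg dihedral_mulgV.

End InfiniteDihedral.

Record digraph := Digraph {
  vertex :> Type;
  arc : vertex -> vertex -> Prop
}.

Definition is_digraph_hom (X Y : digraph) (f : X -> Y) : Prop :=
  forall v w, arc v w -> arc (f v) (f w).

Definition is_digraph_iso (X Y : digraph) (f : X -> Y) : Prop :=
  bijective f /\ forall v w, arc v w <-> arc (f v) (f w).

Definition digraph_isomorphic (X Y : digraph) : Prop :=
  exists f : X -> Y, is_digraph_iso f.

Definition digraph_Z : digraph :=
  @Digraph int (fun i j => j = (i + 1)%R \/ i = (j + 1)%R).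

Definition digraph_vecZ : digraph := @Digraph int (fun i j => j = (i + 1)%R).

Definition adjacent (X : digraph) (v w : X) : Prop := arc v w \/ arc w v.

(* The vertices of the path are p 0, ..., p n; n = 0 is allowed. *)
Definition is_path (X : digraph) (n : nat) (p : nat -> X) : Prop :=
  {in `I_n.+1 &, injective p} /\
  forall i, (i < n)%N -> adjacent (p i) (p i.+1).

Definition path_vertices (X : digraph) (n : nat) (p : nat -> X) : set X :=
  p @` `I_n.+1.

Definition connected (X : digraph) : Prop :=
  forall v w : X, exists n p, [/\ is_path n p, p 0%N = v & p n = w].

Definition is_ray (X : digraph) (r : nat -> X) : Prop :=
  injective r /\ forall i, adjacent (r i) (r i.+1).

(* The k-th path of the family has length n k and vertices
   p k 0, ..., p k (n k). *)
Definition ray_equiv (X : digraph) (r s : nat -> X) : Prop :=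
  exists (n : nat -> nat) (p : nat -> nat -> X),
    (forall k, [/\ is_path (n k) (p k),
                   range r (p k 0%N) & range s (p k (n k))]) /\
    trivIset setT (fun k => path_vertices (n k) (p k)).

Definition end_of (X : digraph) (r : nat -> X) : set (nat -> X) :=
  [set s | is_ray s /\ ray_equiv r s].

Definition ends (X : digraph) : set (set (nat -> X)) :=
  [set end_of r | r in @is_ray X].
Arguments ends : clear implicits.

Definition two_ended (X : digraph) : Prop :=
  connected X /\ (ends X #= `I_2)%card.

Record aut (X : digraph) := Aut {
  aut_fun :> X -> X;
  aut_iso : is_digraph_iso aut_fun
}.

HB.instance Definition _ X := gen_eqMixin (aut X).
HB.instance Definition _ X := gen_choiceMixin (aut X).

Section AutomorphismGroup.
Variable X : digraph.

Lemma aut_ext (f g : aut X) : f =1 g -> f = g.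
Proof.
case: f g => [f fP] [g gP] /= /funext fg; rewrite -{}fg in gP *.
by congr Aut; exact: Prop_irrelevance.
Qed.

Lemma aut_one_subproof : is_digraph_iso (@idfun X).
Proof. by split=> //; exists id. Qed.

Lemma aut_mul_subproof (f g : aut X) : is_digraph_iso (f \o g).
Proof.
have [[bf fP] [bg gP]] := (aut_iso f, aut_iso g).
by split=> [|v w]; [exact: bij_comp|rewrite gP fP].
Qed.

Lemma aut_inv_exists (f : aut X) :
  exists g : aut X, cancel f g /\ cancel g f.
Proof.
have [[g fK gK] fP] := aut_iso f.
have gP : is_digraph_iso g.
  by split=> [|v w]; [exists f|rewrite -{1}[v]gK -{1}[w]gK -fP].
by exists (Aut gP).
Qed.

Definition aut_one : aut X := Aut aut_one_subproof.
Definition aut_mul (f g : aut X) : aut X := Aut (aut_mul_subproof f g).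
Definition aut_inv (f : aut X) : aut X := projT1 (cid (aut_inv_exists f)).

Lemma aut_mulA : associative aut_mul.
Proof. by move=> f g h; apply: aut_ext. Qed.

Lemma aut_mul1g : left_id aut_one aut_mul.
Proof. by move=> f; apply: aut_ext. Qed.

Lemma aut_mulg1 : right_id aut_one aut_mul.
Proof. by move=> f; apply: aut_ext. Qed.

Lemma aut_mulVg : left_inverse aut_one aut_inv aut_mul.
Proof.
move=> f; apply: aut_ext => x /=; rewrite /aut_inv.
by case: cid => g [fK gK] /=; rewrite fK.
Qed.

Lemma aut_mulgV : right_inverse aut_one aut_inv aut_mul.
Proof.
move=> f; apply: aut_ext => x /=; rewrite /aut_inv.
by case: cid => g [fK gK] /=; rewrite gK.
Qed.

HB.instance Definition _ := isGroup.Build (aut X)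
  aut_mulA aut_mul1g aut_mulg1 aut_mulVg aut_mulgV.

End AutomorphismGroup.

Definition vertex_transitive (X : digraph) : Prop :=
  forall v w : X, exists g : aut X, g v = w.

Definition arc_transitive (X : digraph) : Prop :=
  forall v0 v1 w0 w1 : X, arc v0 v1 -> arc w0 w1 ->
    exists g : aut X, g v0 = w0 /\ g v1 = w1.

(* A 2-arc may have equal end vertices v0 = v2. *)
Definition two_arc_transitive (X : digraph) : Prop :=
  forall v0 v1 v2 w0 w1 w2 : X,
    arc v0 v1 -> arc v1 v2 -> arc w0 w1 -> arc w1 w2 ->
    exists g : aut X, [/\ g v0 = w0, g v1 = w1 & g v2 = w2].

Definition end_action (X : digraph) (g : aut X) (e : set (nat -> X)) :
  set (nat -> X) := [set g \o r | r in e].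

Definition transitive_on_ends (X : digraph) : Prop :=
  forall e e', ends X e -> ends X e' -> exists g : aut X, end_action g e = e'.

Definition trivial_on_ends (X : digraph) : Prop :=
  forall (g : aut X) e, ends X e -> end_action g e = e.

Definition orbit (X : digraph) (N : set (aut X)) (v : X) : set X :=
  [set g v | g in N].

Definition finite_orbits (X : digraph) (N : set (aut X)) : Prop :=
  forall v : X, finite_set (orbit N v).

(* Its vertices are the N-orbits, as sets of vertices of X. *)
Definition quotient_digraph (X : digraph) (N : set (aut X)) : digraph :=
  @Digraph (set_type (range (orbit N)))
    (fun A B => exists v w, [/\ \val A v, \val B w & arc v w]).

Definition property_Z (X : digraph) : Prop :=
  connected X /\
  exists f : X -> digraph_vecZ, is_digraph_hom f /\ range f = setT.

Definition dihedral_case (X : digraph) (N : normalSubgroup (aut X)) : Prop :=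
  digraph_isomorphic (quotient_digraph N) digraph_Z /\
  group_isomorphic (quotient_group N) infinite_dihedral.

Definition cyclic_case (X : digraph) (N : normalSubgroup (aut X)) : Prop :=
  digraph_isomorphic (quotient_digraph N) digraph_vecZ /\
  group_isomorphic (quotient_group N) infinite_cyclic.

(* Main.v *)
From HB Require Import structures.
From mathcomp Require Import all_boot all_order all_algebra finmap.
From mathcomp Require Import boolp classical_sets functions cardinality fsbigop.
From mathcomp Require Import zify ring.
(* Imported last: MathComp also has an arc and an orbit. *)
Require Import Defs.

(* The quotient is read off an integer height function on the vertices.

   Two rays lie in different ends iff a finite set of vertices separates them, so
   there are vertex sets A with finite outer boundary containing a tail of one ray
   and missing a tail of the other.  Boundary sizes are submodular, so the sets A
   of least boundary size k are closed under intersection; hence a vertex of A has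
   at most k neighbours lying on boundaries of such sets.  Arc-transitivity spreads
   this bound to all in- or all out-neighbours, and to both unless every minimal
   boundary is closed under predecessors (or successors), which a finite set
   cannot be.  So the digraph is locally finite.

   Now choose a cut A with A and its complement both connected, orient all its
   translates towards the first end, and let the height of w relative to o be the
   number of oriented cuts containing w but not o minus the number containing o
   but not w.  Automorphisms change the height by an isometry of the integers.
   Connectedness forces cuts far from o to contribute with one sign only on each
   side of A, while infinitely many cuts do contribute, so heights are proper.  By
   arc-transitivity all arcs change the height by the same amount up to sign; after
   rescaling, the level sets are the orbits of the kernel N of the action on
   heights, and G/N is the full isometry group or the translation group of Z. *)

Set Implicit Arguments.
Unset Strict Implicit.
Unset Printing Implicit Defensive.

Import Order.TTheory GRing.Theory Num.Theory.

Local Open Scope classical_set_scope.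

(** Vertices form a bare [Type]; counting finite sets of them through [fset_set] needs a choice
    structure, supplied classically. *)
HB.instance Definition _ X := gen_eqMixin (vertex X).
HB.instance Definition _ X := gen_choiceMixin (vertex X).

Lemma injective_avoids_finite (T : Type) (f : nat -> T) (F : set T) :
  injective f -> finite_set F -> exists n, forall m, (n <= m)%N -> ~ F (f m).
Proof.
move=> f_inj finF.
have /finite_fsetP[B FB] : finite_set (f @^-1` F).
  by apply: finite_preimage => // x y _ _; exact: f_inj.
exists (\max_(i <- enum_fset B) i).+1 => m mB Fm.
have mB' : m \in B by have : [set` B] m by rewrite -FB.
by have := @leq_bigmax_seq _ (enum_fset B) xpredT id m mB' isT; rewrite leqNgt mB.
Qed.

(** * Paths, boundaries and ends *)

Section Reachability.
Variable X : digraph.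
Implicit Types (Z A F : set X) (x y z : X).

Lemma adjacent_sym x y : adjacent x y -> adjacent y x.
Proof. by case=> [xy|yx]; [right|left]. Qed.

(** Walks inside [Z], both endpoints included. Vertices may repeat, unlike in [is_path], so that
    walks concatenate freely. *)
Inductive reach Z : X -> X -> Prop :=
| reach_refl x : Z x -> reach Z x x
| reach_step x y z : Z x -> adjacent x y -> reach Z y z -> reach Z x z.

Lemma reach_l Z x y : reach Z x y -> Z x.
Proof. by case. Qed.

Lemma reach_r Z x y : reach Z x y -> Z y.
Proof. by elim. Qed.

Lemma reach_trans Z x y z : reach Z x y -> reach Z y z -> reach Z x z.
Proof. by elim=> // {}x {}y' w Zx xy _ IH /IH; apply: reach_step. Qed.

Lemma reach_adj Z x y : Z x -> Z y -> adjacent x y -> reach Z x y.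
Proof. by move=> Zx Zy xy; apply: (reach_step Zx xy); apply: reach_refl. Qed.

Lemma reach_sym Z x y : reach Z x y -> reach Z y x.
Proof.
elim=> [{}x Zx|{}x {}y z Zx xy yz IH]; first exact: reach_refl.
apply: (reach_trans IH); apply: reach_adj (reach_l yz) Zx _.
exact: adjacent_sym.
Qed.

Lemma reach_sub Z Z' x y : Z `<=` Z' -> reach Z x y -> reach Z' x y.
Proof.
move=> ZZ'; elim=> [{}x Zx|{}x {}y z Zx xy yz IH].
  by apply: reach_refl; apply: ZZ'.
exact: reach_step (ZZ' _ Zx) xy IH.
Qed.

(** Loop erasure: if [x] already occurs on the path built from [y], only the part from that
    occurrence on is kept. *)
Lemma reach_path Z x y : reach Z x y ->
  exists n p, [/\ is_path n p, p 0%N = x, p n = y &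
    forall i, (i <= n)%N -> Z (p i)].
Proof.
elim=> [{}x Zx|{}x {}y z Zx xy yz [n [p [[pinj padj] p0 pn pZ]]]].
  exists 0%N, (fun=> x); split=> //; split=> // i j.
  by rewrite !inE /= => /[!ltnS]/[!leqn0]/eqP-> /eqP->.
have [[i [lein pix]]|xp] := pselect (exists i, (i <= n)%N /\ p i = x).
  exists (n - i)%N, (fun k => p (i + k)%N); split.
  - split=> [a b|a alt]; last by rewrite addnS; apply: padj; lia.
    rewrite !inE /= => an bn pab; apply/(@addnI i)/pinj => //; rewrite inE /=; lia.
  - by rewrite addn0.
  - by rewrite subnKC.
  - by move=> k kn; apply: pZ; lia.
exists n.+1, (fun k => if k is k'.+1 then p k' else x); split=> //.
- split=> [[|a] [|b]|[|a]] //=; rewrite ?inE /=.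
  + by move=> _ bn xb; case: xp; exists b.
  + by move=> an _ xb; case: xp; exists a.
  + by move=> an bn pab; congr _.+1; apply: pinj => //; rewrite inE.
  + by rewrite p0.
  + by move=> an; apply: padj.
- by case=> //= i; rewrite ltnS; exact: pZ.
Qed.

Lemma path_reach Z n (p : nat -> X) : is_path n p ->
  (forall i, (i <= n)%N -> Z (p i)) -> reach Z (p 0%N) (p n).
Proof.
move=> [_ padj] pZ.
suff /(_ n (leqnn n)) : forall k, (k <= n)%N -> reach Z (p 0%N) (p k) by [].
elim=> [_|k IH kn]; first by apply: reach_refl; exact: pZ.
apply: reach_trans (IH (ltnW kn)) _; apply: reach_adj; last exact: padj.
  by apply: pZ; exact: ltnW.
exact: pZ.
Qed.

Lemma connected_reach : connected X -> forall x y, reach setT x y.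
Proof.
by move=> Xc x y; have [n [p [pP <- <-]]] := Xc x y; exact: path_reach.
Qed.

(* The outer vertex boundary. *)
Definition bdry A : set X :=
  [set y | ~ A y /\ exists2 x, A x & adjacent x y].

Lemma bdry_step A x y : A x -> adjacent x y -> ~ bdry A y -> A y.
Proof.
by move=> Ax xy nAy; apply: contrapT => Ay; apply: nAy; split=> //; exists x.
Qed.

Lemma reach_stay Z A x y : reach Z x y -> A x ->
  (forall z, Z z -> ~ bdry A z) -> A y.
Proof.
move=> + + ZA; elim=> [//|{}x {}y z Zx xy yz IH Ax]; apply: IH.
exact: bdry_step Ax xy (ZA _ (reach_l yz)).
Qed.

Definition eventually_in (r : nat -> X) A :=
  exists n, forall m, (n <= m)%N -> A (r m).

Lemma eventually_in_ncontr r A : eventually_in r A -> eventually_in r (~` A) -> False.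
Proof.
move=> [n An] [m Am]; apply: (Am (maxn n m)); first exact: leq_maxr.
by apply: An; exact: leq_maxl.
Qed.

Lemma eventually_inS r A B : A `<=` B -> eventually_in r A -> eventually_in r B.
Proof. by move=> AB [n nA]; exists n => m /nA /AB. Qed.

Lemma eventually_inI r A B :
  eventually_in r A -> eventually_in r B -> eventually_in r (A `&` B).
Proof.
by move=> [n nA] [m mB]; exists (maxn n m) => k; rewrite geq_max => /andP[/nA + /mB].
Qed.

Lemma ray_avoids r F : is_ray r -> finite_set F -> eventually_in r (~` F).
Proof. by move=> [rinj _] /(injective_avoids_finite rinj). Qed.

Lemma ray_segment Z r n i j : is_ray r -> (forall m, (n <= m)%N -> Z (r m)) ->
  (n <= i)%N -> (n <= j)%N -> reach Z (r i) (r j).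
Proof.
move=> [_ radj] rZ.
wlog: i j / (i <= j)%N => [th ni nj|].
  have [ij|ji] := leqP i j; first exact: th.
  by apply: reach_sym; apply: th => //; exact: ltnW.
elim: j => [|j IH].
  by rewrite leqn0 => /eqP-> n0 _; apply/reach_refl/rZ.
rewrite leq_eqVlt => /predU1P[<- ni _|]; first by apply/reach_refl/rZ.
rewrite ltnS => ij ni nj; apply: (@reach_trans _ _ (r j)); first by apply: IH => //; lia.
by apply: reach_adj => //; apply: rZ => //; lia.
Qed.

(** A tail of the ray misses the finite boundary and therefore never crosses it. *)
Lemma ray_side r A : is_ray r -> finite_set (bdry A) ->
  eventually_in r A \/ eventually_in r (~` (A `|` bdry A)).
Proof.
move=> rr finA; have [n nA] := ray_avoids rr finA.
have [Arn|nArn] := pselect (A (r n)); [left|right]; exists n => m nm.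
  by apply: (reach_stay (@ray_segment (~` bdry A) r n n m rr nA (leqnn n) nm) Arn).
move=> [Arm|]; last exact: nA.
apply: nArn; apply: (reach_stay _ Arm).
  exact: (@ray_segment (~` bdry A) r n m n rr nA nm (leqnn n)).
by [].
Qed.

(* Ends via finite separators; unlike [ray_equiv], visibly transitive. *)
Definition eqv (r s : nat -> X) := forall F, finite_set F ->
  exists i j, reach (~` F) (r i) (s j).

Lemma finite_segment (r : nat -> X) n : finite_set (r @` `I_n).
Proof. exact/finite_image/finite_II. Qed.

Lemma eqv_far r s F a b : eqv r s -> finite_set F ->
  exists i j, [/\ (a <= i)%N, (b <= j)%N & reach (~` F) (r i) (s j)].
Proof.
move=> rs finF.
have finF' : finite_set (F `|` (r @` `I_a `|` s @` `I_b)).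
  by rewrite !finite_setU; split=> //; split; exact: finite_segment.
have [i [j ij]] := rs _ finF'; exists i, j; split.
- by rewrite leqNgt; apply/negP => ia; apply: (reach_l ij); right; left; exists i.
- by rewrite leqNgt; apply/negP => ia; apply: (reach_r ij); right; right; exists j.
- by apply: reach_sub ij => x nx Fx; apply: nx; left.
Qed.

Lemma eqv_refl r : is_ray r -> eqv r r.
Proof.
move=> rr F /(ray_avoids rr)[n nF]; exists n, n; apply: reach_refl; exact: nF.
Qed.

Lemma eqv_sym r s : eqv r s -> eqv s r.
Proof. by move=> rs F /rs[i [j ij]]; exists j, i; apply: reach_sym. Qed.

Lemma eqv_trans r s t : is_ray s -> eqv r s -> eqv s t -> eqv r t.
Proof.
move=> sr rs st F finF; have [n nF] := ray_avoids sr finF.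
have [i [j [_ nj ij]]] := eqv_far 0 n rs finF.
have [j' [k [nj' _ jk]]] := eqv_far n 0 st finF.
exists i, k; apply: reach_trans ij _; apply: reach_trans _ jk.
exact: (ray_segment (n := n)).
Qed.

Lemma eqv_side r s A : is_ray s -> eqv r s -> finite_set (bdry A) ->
  eventually_in r A -> eventually_in s A.
Proof.
move=> sr rs finA [n nA].
case: (ray_side sr finA) => // -[m mA].
have [i [j [ni mj ij]]] := eqv_far n m rs finA.
case: (mA _ mj); left; exact: (reach_stay ij (nA _ ni)).
Qed.

(** Only finitely many disjoint paths can meet a finite set, so some path of the family avoids it.
    Conversely, disjoint paths are built greedily, each avoiding the finitely many vertices used
    before. *)
Lemma ray_equivP r s : ray_equiv r s <-> eqv r s.
Proof.
split=> [[n [p [pP /trivIsetP ptriv]]] F finF|rs].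
  suff [k kF] : exists k, forall i, (i <= n k)%N -> ~ F (p k i).
    have [pk [i _ ri] [j _ sj]] := pP k.
    by exists i, j; rewrite ri sj; apply: path_reach.
  apply: contrapT => nk.
  have /choice[f fP] : forall k, exists x, F x /\ path_vertices (n k) (p k) x.
    move=> k; apply: contrapT => nx; apply: nk; exists k => i ik Fi.
    by apply: nx; exists (p k i); split=> //; exists i.
  have finj : injective f.
    move=> a b fab; apply/eqP/negPn/negP => /eqP ab.
    have /eqP/ptriv := ab => /(_ I I)/seteqP[+ _] => /(_ (f a)); apply.
    by split; [case: (fP a)|rewrite fab; case: (fP b)].
  have [m /(_ m (leqnn m))] := injective_avoids_finite finj finF.
  by case: (fP m).
have /choice[f fP] : forall F, exists np : nat * (nat -> X), finite_set F ->
    [/\ is_path np.1 np.2, range r (np.2 0%N), range s (np.2 np.1) &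
      forall i, (i <= np.1)%N -> ~ F (np.2 i)].
  move=> F; have [finF|nF] := pselect (finite_set F); last first.
    by exists (0%N, r) => /nF.
  have [i [j /reach_path[n [p [pP p0 pn pF]]]]] := rs F finF.
  exists (n, p) => _ /=; rewrite p0 pn; split=> //; [by exists i|by exists j].
pose pv F := path_vertices (f F).1 (f F).2.
(* [U k] collects the vertices of the first [k] paths; path number [k] is chosen outside it. *)
pose U := fix U k := if k is k'.+1 then U k' `|` pv (U k') else set0.
have finU k : finite_set (U k).
  elim: k => [//|k IH] /=; rewrite finite_setU; split=> //.
  exact/finite_image/finite_II.
exists (fun k => (f (U k)).1), (fun k => (f (U k)).2); split.
  by move=> k; have [] := fP _ (finU k).
have UU a b : (a <= b)%N -> U a `<=` U b.
  elim: b => [|b IH]; first by rewrite leqn0 => /eqP->.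
  rewrite leq_eqVlt => /predU1P[-> //|]; rewrite ltnS => /IH ab x /ab ?.
  by left.
have key a b : (a < b)%N -> pv (U a) `&` pv (U b) = set0.
  move=> ab; apply/seteqP; split=> // x [xa [i ib xi]].
  have [_ _ _ /(_ i)] := fP _ (finU b); rewrite xi => /(_ ib); case.
  by apply: (UU _ _ ab); right.
apply/trivIsetP => a b _ _ /eqP ab.
by case: (ltngtP a b) => // /key //; rewrite setIC.
Qed.

Lemma end_of_eqv r s : is_ray r -> is_ray s -> end_of r = end_of s <-> eqv r s.
Proof.
move=> rr sr; split=> [rs|rs].
  have : end_of s s by split=> //; apply/ray_equivP/eqv_refl.
  by rewrite -rs => -[_ /ray_equivP].
apply/seteqP; split=> t [tr /ray_equivP qt]; split=> //; apply/ray_equivP.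
  exact: eqv_trans rr (eqv_sym rs) qt.
exact: eqv_trans sr rs qt.
Qed.

Lemma two_ended_rays : two_ended X -> exists r s : nat -> X,
  [/\ is_ray r, is_ray s, ~ eqv r s &
      forall t, is_ray t -> eqv t r \/ eqv t s].
Proof.
move=> [_ /card_set_bijP[f [fI finj fsurj]]].
have [e0 [r rr re0] fe0] := fsurj 0%N isT.
have [e1 [s sr se1] fe1] := fsurj 1%N isT.
exists r, s; split=> //.
  move=> /(end_of_eqv rr sr) rs; have : f e0 = f e1 by rewrite -re0 rs se1.
  by rewrite fe0 fe1.
move=> t tr; have te : ends X (end_of t) by exists t.
have := fI _ te; rewrite /=.
case E: (f (end_of t)) => [|[|//]] _; [left|right]; apply/end_of_eqv => //.
  by rewrite re0; apply: finj; rewrite ?inE ?E ?fe0 //; exists r.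
by rewrite se1; apply: finj; rewrite ?inE ?E ?fe1 //; exists s.
Qed.

End Reachability.

(** * Minimal separators and local finiteness *)

Section AutAction.
Variable X : digraph.
Implicit Types (A F : set X) (g : aut X) (r s : nat -> X).

Lemma autK g : cancel g (g^-1)%g.
Proof. by move=> x; have := congr1 (@aut_fun X ^~ x) (mulVg g). Qed.

Lemma autKV g : cancel (g^-1)%g g.
Proof. by move=> x; have := congr1 (@aut_fun X ^~ x) (mulgV g). Qed.

Lemma aut_inj g : injective g.
Proof. exact: can_inj (autK g). Qed.

Lemma aut_arc g x y : arc (g x) (g y) <-> arc x y.
Proof. by have [_ gP] := aut_iso g; exact: iff_sym. Qed.

Lemma aut_adj g x y : adjacent (g x) (g y) <-> adjacent x y.
Proof. by rewrite /adjacent !aut_arc. Qed.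

Lemma bdry_preimage g A : bdry (g @^-1` A) = g @^-1` bdry A.
Proof.
apply/seteqP; split=> y /= [nAy [x Ax xy]]; split=> //.
  by exists (g x) => //; apply/aut_adj.
by exists ((g^-1)%g x); rewrite /= ?autKV // -(aut_adj g) autKV.
Qed.

Lemma finite_aut_preimage g A : finite_set A -> finite_set (g @^-1` A).
Proof. by apply: finite_preimage => x y _ _; exact: aut_inj. Qed.

Lemma aut_ray g r : is_ray r -> is_ray (g \o r).
Proof.
move=> [rinj radj]; split=> [|i /=]; first exact: inj_comp (@aut_inj g) rinj.
by apply/aut_adj.
Qed.

Lemma aut_reach g F x y : reach (g @^-1` F) x y -> reach F (g x) (g y).
Proof.
elim=> [{}x Fx|{}x {}y z Fx xy yz IH]; first exact: reach_refl.
by apply: reach_step IH => //; apply/aut_adj.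
Qed.

Lemma aut_eqv g r s : eqv r s -> eqv (g \o r) (g \o s).
Proof.
move=> rs F /(finite_aut_preimage g)/rs[i [j ij]]; exists i, j.
exact: aut_reach.
Qed.

Lemma aut_eqvV g r s : eqv (g \o r) (g \o s) -> eqv r s.
Proof.
move=> /(aut_eqv (g^-1)%g).
by congr eqv; apply/funext => i /=; rewrite autK.
Qed.

End AutAction.

(** * Submodularity and tight separating sets *)

Section Separations.
Variable X : digraph.
Implicit Types (A B : set X) (r s : nat -> X).

(** Plays the role of the complement, whose own boundary could be infinite as long as local
    finiteness is not established. *)
Definition far_side A : set X := ~` (A `|` bdry A).

Definition separates r s A :=
  [/\ finite_set (bdry A), eventually_in r A & eventually_in s (~` A)].

Definition cut_size A := #|` fset_set (bdry A)|.

Lemma leq_cut_size A B : bdry A `<=` bdry B -> finite_set (bdry B) ->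
  (cut_size A <= cut_size B)%N.
Proof.
move=> AB finB; have finA := sub_finite_set AB finB.
by apply: fsubset_leq_card; rewrite -fset_set_sub.
Qed.

Lemma bdry_far_side A : bdry (far_side A) `<=` bdry A.
Proof.
move=> y [/contrapT nAy [x Ax xy]]; case: nAy => // Ay.
case: Ax; have [|nAx] := pselect (A x); [by left|right; split=> //].
by exists y => //; exact: adjacent_sym.
Qed.

Lemma separates_far_side r s A : is_ray s ->
  separates r s A -> separates s r (far_side A).
Proof.
move=> sr [finA rA sA]; split.
- exact: sub_finite_set (@bdry_far_side A) finA.
- by case: (ray_side sr finA) => // /eventually_in_ncontr.
- by apply: eventually_inS rA => x Ax nAx; apply: nAx; left.
Qed.

Lemma bdryI A B : bdry (A `&` B) `<=` bdry A `|` bdry B.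
Proof.
move=> y [nAB [x [Ax Bx] xy]].
have [Ay|nAy] := pselect (A y); [right|left]; split=> //; try by exists x.
by move=> By; apply: nAB.
Qed.

Lemma bdryU A B : bdry (A `|` B) `<=` bdry A `|` bdry B.
Proof.
move=> y [nAB [x [Ax|Bx] xy]]; [left|right]; split; try by exists x.
  by move=> Ay; apply: nAB; left.
by move=> By; apply: nAB; right.
Qed.

Lemma bdryIU A B : bdry (A `&` B) `&` bdry (A `|` B) `<=` bdry A `&` bdry B.
Proof.
move=> y [[_ [x [Ax Bx] xy]] [nAB _]].
by split; split; [move=> ?; apply: nAB; left|exists x|
  move=> ?; apply: nAB; right|exists x].
Qed.

(** The two boundaries on the left have their union inside [bdry A] united with [bdry B] and their
    intersection inside the intersection; inclusion-exclusion on both sides gives the inequality. *)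
Lemma cut_size_submodular A B : finite_set (bdry A) -> finite_set (bdry B) ->
  (cut_size (A `&` B) + cut_size (A `|` B) <= cut_size A + cut_size B)%N.
Proof.
move=> finA finB.
have finAB : finite_set (bdry A `|` bdry B) by rewrite finite_setU.
have finI := sub_finite_set (@bdryI A B) finAB.
have finU := sub_finite_set (@bdryU A B) finAB.
rewrite /cut_size -cardfsUI -[leqRHS]cardfsUI -!fset_setU // -!fset_setI //.
apply: leq_add; apply: fsubset_leq_card.
  rewrite -fset_set_sub ?finite_setU // subUset.
  by split; [exact: bdryI|exact: bdryU].
by rewrite -fset_set_sub; [exact: bdryIU|exact: finite_setIl|exact: finite_setIl].
Qed.

Lemma separatesI r s A B :
  separates r s A -> separates r s B -> separates r s (A `&` B).
Proof.
move=> [finA rA sA] [finB rB sB]; split.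
- by apply: sub_finite_set (@bdryI A B) _; rewrite finite_setU.
- exact: eventually_inI.
- by apply: eventually_inS sA => x nA [].
Qed.

Lemma separatesU r s A B :
  separates r s A -> separates r s B -> separates r s (A `|` B).
Proof.
move=> [finA rA sA] [finB rB sB]; split.
- by apply: sub_finite_set (@bdryU A B) _; rewrite finite_setU.
- by apply: eventually_inS rA => x; left.
- by rewrite setCU; exact: eventually_inI.
Qed.

Lemma separates_eqv r s r' s' A : is_ray s -> is_ray r' -> is_ray s' ->
  eqv r r' -> eqv s s' -> separates r s A -> separates r' s' A.
Proof.
move=> sr rr' sr' er es [finA rA sA]; split=> //.
  exact: eqv_side er finA rA.
have [/(eqv_side sr (eqv_sym es) finA) sA'|] := ray_side sr' finA.
  by case: (eventually_in_ncontr sA').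
by apply: eventually_inS => x nAx Ax; apply: nAx; left.
Qed.

(** Take everything reachable from [r] outside a finite separator [F]; the boundary of this set lies
    in [F]. *)
Lemma separates_exists r s : is_ray r -> ~ eqv r s ->
  exists A, separates r s A.
Proof.
move=> rr nrs.
have [F finF Fsep] : exists2 F, finite_set F &
    forall i j, ~ reach (~` F) (r i) (s j).
  apply: contrapT => nF; apply: nrs => F finF; apply: contrapT => nij.
  by apply: nF; exists F => // i j ij; apply: nij; exists i, j.
exists [set x | exists i, reach (~` F) (r i) x]; split.
- apply: sub_finite_set finF => y [ny [x [i ix] xy]]; apply: contrapT => Fy.
  apply: ny; exists i; apply: (reach_trans ix).
  by apply: reach_adj => //; exact: (reach_r ix).
- have [n nF] := ray_avoids rr finF.
  by exists n => m nm; exists m; apply/reach_refl/nF.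
- by exists 0%N => m _ [i /Fsep].
Qed.

Definition tight r s A :=
  separates r s A /\ forall B, separates r s B -> (cut_size A <= cut_size B)%N.

Lemma tight_exists r s : is_ray r -> ~ eqv r s -> exists A, tight r s A.
Proof.
move=> rr nrs; have [A0 A0sep] := separates_exists rr nrs.
pose P n := `[< exists2 A, separates r s A & cut_size A = n >].
have exP : exists n, P n by exists (cut_size A0); apply/asboolP; exists A0.
case: (ex_minnP exP) => k /asboolP[A Asep <-] kmin; exists A; split=> // B Bsep.
by apply: kmin; apply/asboolP; exists B.
Qed.

(** Passing to [far_side B] reverses the direction without enlarging the boundary, so the least
    boundary size is the same in both directions. *)
Lemma tight_le_flip r s A B : is_ray r ->
  tight r s A -> separates s r B -> (cut_size A <= cut_size B)%N.
Proof.
move=> rr [_ Amin] Bsep; have [finB _ _] := Bsep.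
apply: leq_trans (Amin _ (separates_far_side rr Bsep)) _.
exact: leq_cut_size (@bdry_far_side B) finB.
Qed.

Lemma tight_far_side r s A : is_ray r -> is_ray s ->
  tight r s A -> tight s r (far_side A).
Proof.
move=> rr sr At; have [[finA _ _] _] := At; split.
  by apply: separates_far_side; case: At.
move=> B Bsep; apply: leq_trans (tight_le_flip rr At Bsep).
exact: leq_cut_size (@bdry_far_side A) finA.
Qed.

(* Minimality: [far_side A] separates as well, so its boundary cannot be smaller. *)
Lemma bdry_tight_far_side r s A : is_ray r -> is_ray s ->
  tight r s A -> bdry (far_side A) = bdry A.
Proof.
move=> rr sr At; have [Asep _] := At; have [finA _ _] := Asep.
have Asep' := separates_far_side sr Asep; have [finA' _ _] := Asep'.
rewrite -[LHS]fset_setK // -[RHS]fset_setK //.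
suff -> : fset_set (bdry (far_side A)) = fset_set (bdry A) by [].
apply/eqP; rewrite eqEfcard; apply/andP; split.
  by rewrite -fset_set_sub //; exact: bdry_far_side.
exact: tight_le_flip At Asep'.
Qed.

(** The union also separates, so its boundary is at least minimal; submodularity then leaves no room
    for the intersection to exceed the minimum. *)
Lemma tightI r s A B : tight r s A -> tight r s B -> tight r s (A `&` B).
Proof.
move=> [Asep Amin] [Bsep Bmin]; split=> [|C Csep]; first exact: separatesI.
have [finA _ _] := Asep; have [finB _ _] := Bsep.
have := cut_size_submodular finA finB.
have := Bmin _ (separatesU Asep Bsep); have := Amin _ Csep; lia.
Qed.

(* Finitely many such neighbours of v lie together on the boundary of an
   intersection of tight sets, which has only [cut_size A] vertices. *)
Lemma tight_degree r s v : is_ray r -> ~ eqv r s -> finite_set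
  [set w | adjacent v w /\ exists A, [/\ tight r s A, A v & bdry A w]].
Proof.
move=> rr nrs; have [A0 A0t] := tight_exists rr nrs.
apply: contrapT => /(infinite_set_fset (cut_size A0).+1)[W].
pose P w := adjacent v w /\ exists A, [/\ tight r s A, A v & bdry A w].
have common ws w0 : (forall w, w \in w0 :: ws -> P w) -> exists A,
    [/\ tight r s A, A v & forall w, w \in w0 :: ws -> bdry A w].
  elim: ws w0 => [|w1 ws IH] w0 wP; have [vw0 [A [At Av Aw0]]] := wP _ (mem_head _ _).
    by exists A; split=> // w; rewrite inE => /eqP->.
  have [|B [Bt Bv Bws]] := IH w1; first by move=> w ww; apply: wP; rewrite inE ww orbT.
  exists (A `&` B); split; [exact: tightI|by []|move=> w].
  (* [w] lies outside one of the two sets and is adjacent to [v], which lies in both. *)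
  have bI : bdry A w \/ bdry B w -> P w -> bdry (A `&` B) w.
    by move=> AB [vw _]; split; [move=> -[Aw Bw]; case: AB => -[]|exists v].
  move=> ww; apply: bI; last exact: wP.
  by move: ww; rewrite inE => /predU1P[->|/Bws]; [left|right].
move=> WP Wsize; case E : (enum_fset W) => [|w0 ws]; first by move: Wsize; rewrite E.
have [|A [[Asep Amin] Av AW]] := @common ws w0.
  by move=> w; rewrite -E; exact: WP.
have [finA _ _] := Asep; have [A0sep _] := A0t.
have := Amin _ A0sep; rewrite leqNgt => /negP; apply.
apply: leq_trans Wsize _; apply: fsubset_leq_card; apply/fsubsetP => w wW.
by rewrite in_fset_set // inE; apply: AW; rewrite -E.
Qed.

End Separations.

(* Iterating a choice of predecessors inside a finite S of the family closes a
   directed cycle; a member separating two consecutive vertices of the cycle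
   would contain the whole cycle. *)
Lemma no_predecessor_closed_family (T : Type) (R : T -> T -> Prop)
    (C : set (set T)) :
  (forall S, C S -> finite_set S) ->
  (forall S x y, C S -> S y -> R x y -> S x) ->
  (forall x y, R x y -> exists S, [/\ C S, S x & ~ S y]) ->
  (forall y, exists x, R x y) ->
  forall S y, C S -> ~ S y.
Proof.
move=> Cfin Cpred Csep /choice[p pR] S y CS Sy.
have itS S' n x : C S' -> S' x -> S' (iter n p x).
  by move=> CS' S'x; elim: n => [//|n IH] /=; apply: Cpred IH (pR _).
have [i [j [ij pij]]] : exists i j, (i < j)%N /\ iter i p y = iter j p y.
  apply: contrapT => ninj.
  have pinj : injective (fun n => iter n p y).
    move=> i j pij; case: (ltngtP i j) => // ij; case: ninj.
      by exists i, j.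
    by exists j, i.
  have [n /(_ n (leqnn n))] := injective_avoids_finite pinj (Cfin _ CS).
  by apply; exact: itS.
have [S' [CS' S'pz S'z]] := Csep _ _ (pR (iter i p y)); apply: S'z.
(* Once round the cycle, [iter i p y] is an iterated predecessor of [p (iter i p y)], so the closed
   set [S'] contains it too. *)
have -> : iter i p y = iter (j - i).-1 p (p (iter i p y)).
  by rewrite -iterSr prednK ?subn_gt0 // -iterD subnK // ltnW.
exact: itS.
Qed.

(** * Automorphisms and the two ends; local finiteness *)

Section TwoEnded.
Variables (X : digraph) (r s : nat -> X).
Hypotheses (rr : is_ray r) (sr : is_ray s) (nrs : ~ eqv r s).
Hypothesis ends_rs : forall t, is_ray t -> eqv t r \/ eqv t s.
Hypothesis conn : forall x y : X, reach setT x y.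

(** Automorphisms keep inequivalent rays inequivalent, and only two classes are available. *)
Lemma aut_ends (g : aut X) :
  (eqv r (g \o r) /\ eqv s (g \o s)) \/ (eqv r (g \o s) /\ eqv s (g \o r)).
Proof.
have sgr : ~ eqv (g \o r) (g \o s) by move=> /aut_eqvV.
have gr := aut_ray g rr; have gs := aut_ray g sr.
case: (ends_rs gr) => er; case: (ends_rs gs) => es.
- by case: sgr; apply: (eqv_trans rr er); exact: eqv_sym.
- by left; split; exact: eqv_sym.
- by right; split; exact: eqv_sym.
- by case: sgr; apply: (eqv_trans sr er); exact: eqv_sym.
Qed.

Lemma cut_size_preimage (g : aut X) (A : set X) : finite_set (bdry A) ->
  (cut_size (g @^-1` A) <= cut_size A)%N.
Proof.
move=> finA; rewrite /cut_size bdry_preimage.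
have -> : g @^-1` bdry A = (g^-1)%g @` bdry A.
  apply/seteqP; split=> [x Ax|_ [x Ax <-]]; last by rewrite /= autKV.
  by exists (g x) => //; rewrite autK.
by rewrite fset_set_image //; exact: leq_imfset_card.
Qed.


Definition tight_cut A := tight r s A \/ tight s r A.

Lemma tight_cut_preimage (g : aut X) A : tight_cut A -> tight_cut (g @^-1` A).
Proof.
have rg := aut_ray g rr; have sg := aut_ray g sr.
case=> At; have [Asep Amin] := At; have [finA _ _] := Asep;
  have gA := cut_size_preimage g finA;
  case: (aut_ends g) => -[er es]; [left|right|right|left].
- have [fin' r' s'] := separates_eqv sr rg sg er es Asep; split=> [|B Bsep].
    by split=> //; rewrite bdry_preimage; exact: finite_aut_preimage.
  exact: leq_trans gA (Amin _ Bsep).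
- have [fin' r' s'] := separates_eqv sr sg rg er es Asep; split=> [|B Bsep].
    by split=> //; rewrite bdry_preimage; exact: finite_aut_preimage.
  exact: leq_trans gA (tight_le_flip rr At Bsep).
- have [fin' r' s'] := separates_eqv rr sg rg es er Asep; split=> [|B Bsep].
    by split=> //; rewrite bdry_preimage; exact: finite_aut_preimage.
  exact: leq_trans gA (Amin _ Bsep).
- have [fin' r' s'] := separates_eqv rr rg sg es er Asep; split=> [|B Bsep].
    by split=> //; rewrite bdry_preimage; exact: finite_aut_preimage.
  exact: leq_trans gA (tight_le_flip sr At Bsep).
Qed.

Lemma tight_cut_finite A : tight_cut A -> finite_set (bdry A).
Proof. by case=> -[[]]. Qed.

(** A vertex off the boundary lies in [A] or in [far_side A], which is tight in the other direction
    with the same boundary; [tight_degree] applies once per direction. *)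
Lemma tight_cut_degree v : finite_set
  [set w | adjacent v w /\ exists A, [/\ tight_cut A, ~ bdry A v & bdry A w]].
Proof.
have nsr : ~ eqv s r by move=> /eqv_sym.
have := tight_degree v rr nrs; have := tight_degree v sr nsr => fin1 fin2.
have fin12 := conj fin2 fin1; rewrite -finite_setU in fin12.
apply: sub_finite_set fin12 => w [vw [A [At nAv Aw]]].
have [Av|nAv'] := pselect (A v).
  by case: At => At; [left|right]; split=> //; exists A.
have fAv : far_side A v by case.
case: At => At; [right|left]; split=> //; exists (far_side A).
  by rewrite (bdry_tight_far_side rr sr At); split=> //; exact: tight_far_side.
by rewrite (bdry_tight_far_side sr rr At); split=> //; exact: tight_far_side.
Qed.

Lemma separates_bdry_edge A : separates r s A ->
  exists x y, [/\ A x, bdry A y & adjacent x y].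
Proof.
move=> [_ [n rA] [m sA]]; apply: contrapT => nxy.
apply: (sA m (leqnn m)).
apply: (reach_stay (conn (r n) (s m)) (rA n (leqnn n))) => y _ Ay.
by have [_ [x Ax xy]] := Ay; apply: nxy; exists x, y.
Qed.

Hypotheses (vtrans : vertex_transitive X) (atrans : arc_transitive X).

Lemma locally_finite v : finite_set [set w : X | adjacent v w].
Proof.
have [A0 A0t] := tight_exists rr nrs.
have A0c : tight_cut A0 by left.
have [x0 [y0 [A0x0 A0y0 xy0]]] : exists x y, [/\ A0 x, bdry A0 y & adjacent x y].
  by case: A0t => /separates_bdry_edge.
have nA0x0 : ~ bdry A0 x0 by case.
have out (x : X) : exists y, arc x y.
  have [a [b ab]] : exists a b : X, arc a b.
    by case: xy0; [exists x0, y0|exists y0, x0].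
  by have [g <-] := vtrans a x; exists (g b); apply/aut_arc.
have inn (y : X) : exists x, arc x y.
  have [a [b ab]] : exists a b : X, arc a b.
    by case: xy0; [exists x0, y0|exists y0, x0].
  by have [g <-] := vtrans b y; exists (g a); apply/aut_arc.
pose bdrys := [set S | exists2 A, tight_cut A & S = bdry A].
have bdrys_fin S : bdrys S -> finite_set S.
  by move=> [A /tight_cut_finite + ->].
(* By arc-transitivity, one arc leaving (entering) a tight boundary yields, for every arc, a tight
   boundary that it leaves (enters). *)
pose leaving := exists A x y, [/\ tight_cut A, bdry A x, ~ bdry A y & arc x y].
pose entering := exists A x y, [/\ tight_cut A, ~ bdry A x, bdry A y & arc x y].
have leavingP : leaving -> forall x y, arc x y ->
    exists A, [/\ tight_cut A, bdry A x & ~ bdry A y].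
  move=> [A [x' [y' [At Ax' nAy' xy']]]] x y xy.
  have [g [gx gy]] := atrans xy xy'; exists (g @^-1` A).
  by split; rewrite ?bdry_preimage /= ?gx ?gy //; exact: tight_cut_preimage.
have enteringP : entering -> forall x y, arc x y ->
    exists A, [/\ tight_cut A, ~ bdry A x & bdry A y].
  move=> [A [x' [y' [At Ax' nAy' xy']]]] x y xy.
  have [g [gx gy]] := atrans xy xy'; exists (g @^-1` A).
  by split; rewrite ?bdry_preimage /= ?gx ?gy //; exact: tight_cut_preimage.
(* Otherwise tight boundaries are closed under successors, and the edge [xy0] gives an entering arc;
   reversing all arcs brings this to the forbidden closed family. *)
have isleaving : leaving.
  apply: contrapT => nleav.
  have ent : entering.
    case: xy0 => [xy|yx]; first by exists A0, x0, y0.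
    by case: nleav; exists A0, y0, x0.
  apply: (@no_predecessor_closed_family _ (fun x y => arc y x) bdrys bdrys_fin
    _ _ out (bdry A0) y0) => //; last by exists A0.
    move=> S x y [A At ->] Ay yx; apply: contrapT => nAx.
    by apply: nleav; exists A, y, x.
  move=> x y /(enteringP ent)[A [At nAy Ax]].
  by exists (bdry A); split=> //; exists A.
(* Otherwise tight boundaries are closed under predecessors, and leaving arcs separate consecutive
   vertices. *)
have isentering : entering.
  apply: contrapT => nent.
  apply: (@no_predecessor_closed_family _ (fun x y => arc x y) bdrys bdrys_fin
    _ _ inn (bdry A0) y0) => //; last by exists A0.
    move=> S x y [A At ->] Ay xy; apply: contrapT => nAx.
    by apply: nent; exists A, x, y.
  move=> x y /(leavingP isleaving)[A [At nAy Ax]].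
  by exists (bdry A); split=> //; exists A.
(* Entering arcs handle the out-neighbours of [v], leaving arcs the in-neighbours. *)
apply: sub_finite_set (tight_cut_degree v) => w vw; split=> //.
case: vw => [/(enteringP isentering)//|/(leavingP isleaving)].
by move=> [A [At Aw nAv]]; exists A.
Qed.

End TwoEnded.

(** * Cuts with connected sides *)

Section LocallyFinite.
Variable X : digraph.
Implicit Types (A C F Y Z : set X) (v w x y z : X) (g : aut X).

(** Cut the walk after its last visit to [a]. *)
Lemma reach_avoiding Z a x z : reach Z x z -> z <> a ->
  reach (Z `\ a) x z \/ exists2 y, adjacent a y & reach (Z `\ a) y z.
Proof.
elim=> [{}x Zx xa|{}x y {}z Zx xy _ IH za]; first by left; apply: reach_refl; split.
case: (IH za) => [yz|]; last by right.
have [xa|xa] := pselect (x = a); first by right; exists y => //; rewrite -xa.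
by left; apply: reach_step xy yz; split.
Qed.

Lemma reach_exit Y x z : reach setT x z -> Y x ->
  reach Y x z \/ exists2 b, bdry (~` Y) b & reach Y x b.
Proof.
elim=> [{}x _ Yx|{}x y {}z _ xy _ IH Yx]; first by left; exact: reach_refl.
have [Yy|nYy] := pselect (Y y); last first.
  right; exists x; last exact: reach_refl.
  by split=> //; exists y => //; exact: adjacent_sym.
case: (IH Yy) => [yz|[b Yb yb]]; first by left; exact: reach_step xy yz.
by right; exists b => //; exact: reach_step xy yb.
Qed.

Lemma bdry_component Z a : bdry [set x | reach Z a x] `<=` bdry Z.
Proof.
move=> y [nay [x ax xy]]; split; last by exists x => //; exact: (reach_r ax).
move=> Zy; apply: nay; apply: (reach_trans ax).
by apply: reach_adj xy => //; exact: (reach_r ax).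
Qed.

Hypothesis lf : forall v, finite_set [set w | adjacent v w].

Lemma finite_bdryC A : finite_set (bdry A) -> finite_set (bdry (~` A)).
Proof.
move=> finA.
apply: (@sub_finite_set _ _ (\bigcup_(y in bdry A) [set w | adjacent y w])).
  move=> x [/contrapT Ax [y nAy yx]]; exists y => //.
  by split=> //; exists x => //; exact: adjacent_sym.
exact: bigcup_finite.
Qed.

Hypothesis conn : forall x y, reach setT x y.

(** Koenig's lemma. Every component of [Y] contains [y0] or one of the finitely many vertices of [Y]
    with a neighbour outside, so some component is infinite. Deleting the current vertex leaves a
    neighbour whose remaining component is still infinite. *)
Lemma infinite_ray Y : infinite_set Y -> finite_set (bdry Y) ->
  exists t, is_ray t /\ forall n, Y (t n).
Proof.
move=> infY /finite_bdryC finY.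
have [y0 Yy0] := infinite_setN0 infY.
have [b binf] : exists b, infinite_set [set y | reach Y b y].
  apply: contrapT => nb; apply: infY.
  apply: (@sub_finite_set _ _
    (\bigcup_(b in y0 |` bdry (~` Y)) [set y | reach Y b y])).
    move=> y Yy; have [yy0|[b Yb yb]] := reach_exit (conn y y0) Yy.
      by exists y0; [left|exact: reach_sym].
    by exists b; [right|exact: reach_sym].
  apply: bigcup_finite => [|b _]; first by rewrite finite_setU.
  by apply: contrapT => ?; apply: nb; exists b.
pose big Z x := infinite_set [set y | reach Z x y].
have bigS Z x : big Z x -> exists2 y, adjacent x y & big (Z `\ x) y.
  move=> infx; apply: contrapT => ny; apply: infx.
  apply: (@sub_finite_set _ _ (x |` \bigcup_(y in [set w | adjacent x w])
      [set z | reach (Z `\ x) y z])).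
    move=> z xz; have [->|/eqP zx] := eqVneq z x; first by left.
    case: (reach_avoiding xz zx) => [/reach_l[_ []]//|[y xy yz]].
    by right; exists y.
  rewrite finite_setU; split=> //; apply: bigcup_finite => // y xy.
  by apply: contrapT => ?; apply: ny; exists y.
have /choice[f fP] : forall Zx : set X * X, exists y, big Zx.1 Zx.2 ->
    adjacent Zx.2 y /\ big (Zx.1 `\ Zx.2) y.
  move=> [Z x] /=; have [/bigS[y xy ybig]|] := pselect (big Z x).
    by exists y.
  by exists x.
(* A state is the set of vertices still allowed together with the current vertex; deletions make the
   ray injective. *)
pose st n := iter n (fun Zx => (Zx.1 `\ Zx.2, f Zx)) (Y, b).
have stbig n : big (st n).1 (st n).2.
  by elim: n => [//|n /fP[]].
have stin n : (st n).1 (st n).2.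
  by have [z /reach_l] := infinite_setN0 (stbig n).
have st_sub n m : (st (m + n)).1 `<=` (st n).1.
  by elim: m => [//|m IH] x [/IH].
exists (fun n => (st n).2); split; [split|].
- have key i j : (i < j)%N -> (st i).2 <> (st j).2.
    move=> ij stij; have : (st (j - i.+1 + i.+1)%N).1 (st j).2 by rewrite subnK.
    by move=> /st_sub[_ nij]; apply: nij; rewrite /= stij.
  by move=> i j stij; case: (ltngtP i j) => // /key; rewrite stij.
- by move=> i; have [] := fP _ (stbig i).
- by move=> n; have := st_sub 0%N n; rewrite addn0; apply.
Qed.

End LocallyFinite.

(** * Cuts, balls and connected sides *)

Section Cuts.
Variable X : digraph.
Implicit Types (A C F Y Z : set X) (v w x y z : X) (g : aut X).

Definition conn_set Z := forall x y, Z x -> Z y -> reach Z x y.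

(* The vertices incident with an edge between C and its complement. *)
Definition cut_ends C := bdry C `|` bdry (~` C).

Lemma cut_endsC C : cut_ends (~` C) = cut_ends C.
Proof. by rewrite /cut_ends setCK setUC. Qed.

Lemma cut_ends_preimage g C : cut_ends (g @^-1` C) = g @^-1` cut_ends C.
Proof.
by rewrite /cut_ends bdry_preimage preimage_setC bdry_preimage preimage_setU.
Qed.

Lemma cut_endsP C x y : adjacent x y -> C x -> ~ C y ->
  cut_ends C x /\ cut_ends C y.
Proof.
move=> xy Cx Cy; split; [right|left]; split=> //; last by exists x.
by exists y => //; exact: adjacent_sym.
Qed.

Lemma cut_ends_nbr C x : C x -> cut_ends C x -> exists2 y, ~ C y & adjacent x y.
Proof.
by move=> Cx [[//]|[_ [y Cy yx]]]; exists y => //; exact: adjacent_sym.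
Qed.

Lemma reach_cut Z C x y : reach Z x y -> C x ->
  (forall z, Z z -> ~ cut_ends C z) -> C y.
Proof.
by move=> xy Cx ZC; apply: reach_stay xy Cx _ => z /ZC nC bz; apply: nC; left.
Qed.

Lemma conn_set_sub Z C x : conn_set Z -> Z x -> C x ->
  (forall z, Z z -> ~ cut_ends C z) -> Z `<=` C.
Proof. by move=> Zconn Zx Cx ZC y Zy; apply: reach_cut (Zconn _ _ Zx Zy) Cx ZC. Qed.

Lemma aut_conn_set g Z : conn_set Z -> conn_set (g @^-1` Z).
Proof.
move=> Zconn x y Zx Zy; rewrite -[x](autK g) -[y](autK g); apply: aut_reach.
rewrite -comp_preimage (_ : _ \o _ = id) ?preimage_id; first exact: Zconn.
by apply/funext => u /=; rewrite autKV.
Qed.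

(** The ball of radius [n] about [x] in the underlying undirected graph. *)
Fixpoint near n x y := if n is n'.+1 then
  near n' x y \/ exists2 u, near n' x u & adjacent u y else x = y.

Lemma near_trans n m x y z : near n x y -> near m y z -> near (n + m) x z.
Proof.
move=> xy; elim: m z => [|m IH] z /=; first by move=> <-; rewrite addn0.
rewrite addnS /= => -[/IH|[u /IH yu uz]]; first by left.
by right; exists u.
Qed.

Lemma near_sym n x y : near n x y -> near n y x.
Proof.
elim: n x y => [//|n IH] x y /= [/IH|[u /IH ux uy]]; first by left.
have : near 1 y u by right; exists y => //; exact: adjacent_sym.
by move=> /near_trans /(_ ux); rewrite add1n.
Qed.

Lemma near_refl n x : near n x x.
Proof. by elim: n => [//|n IH]; left. Qed.

Lemma near_reach n x y : near n x y -> reach (near n x) x y.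
Proof.
elim: n y => [y /= <-|n IH y /= xy]; first exact: reach_refl.
have sub : near n x `<=` near n.+1 x by move=> u; left.
case: (xy) => [/IH|[u /IH xu uy]]; first exact: reach_sub.
apply: (reach_trans (reach_sub sub xu)); apply: reach_adj uy => //.
by left; exact: (reach_r xu).
Qed.

Lemma conn_set_near n x : conn_set (near n x).
Proof.
move=> y z /near_reach xy /near_reach; apply: reach_trans; exact: reach_sym.
Qed.

Lemma aut_near g n x y : near n x y -> near n (g x) (g y).
Proof.
elim: n y => [y /= ->//|n IH y /= [/IH|[u /IH xu uy]]]; first by left.
by right; exists (g u) => //; apply/aut_adj.
Qed.

Hypothesis conn : forall x y, reach setT x y.

Lemma near_exists x y : exists n, near n x y.
Proof.
elim: (reach_sym (conn x y)) => [z _|z u {}x _ yu _ [n xu]]; first by exists 0%N.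
by exists n.+1; right; exists u => //; exact: adjacent_sym.
Qed.

Lemma finite_near F x : finite_set F -> exists n, F `<=` near n x.
Proof.
have /choice[d dP] := near_exists x.
move=> /(finite_image d)/finite_fsetP[B BE].
have near_le n m : (n <= m)%N -> near n x `<=` near m x.
  move=> nm y xy; rewrite -(subnKC nm); exact: near_trans xy (near_refl _ _).
exists (\max_(i <- enum_fset B) i) => y Fy; apply: near_le (dP y).
apply: (@leq_bigmax_seq _ (enum_fset B) xpredT id) => //.
by have : [set` B] (d y) by rewrite -BE; exists y.
Qed.

(* Walking from y to F, membership in C can only change at vertices of F. *)
Lemma cut_trace_inj F x C C' : F x -> cut_ends C `<=` F -> cut_ends C' `<=` F ->
  C `&` F = C' `&` F -> C = C'.
Proof.
move=> Fx CF CF' CC'.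
have keyF y : F y -> C y <-> C' y.
  move=> Fy; split=> Cy; first by have [] : (C' `&` F) y by rewrite -CC'.
  by have [] : (C `&` F) y by rewrite CC'.
have key y : C y <-> C' y.
  elim: (conn y x) Fx => [z _ Fz|{}y u z _ yu _ IH Fz].
    exact: keyF.
  have [Fy|nFy] := pselect (F y); first exact: keyF.
  have yuE D : cut_ends D `<=` F -> D y <-> D u.
    move=> DF; split=> Dy; apply: contrapT => nDu; apply: nFy; apply: DF.
      by case: (cut_endsP yu Dy nDu).
    by case: (cut_endsP (adjacent_sym yu) Dy nDu).
  by rewrite !yuE //; exact: IH.
by apply/seteqP; split=> y /key.
Qed.

(** A cut is determined by its trace on [F], and [F] has finitely many subsets; [f] recovers the cut
    from its trace, with [set0] as a dummy value. *)
Lemma finite_cuts F x : F x -> finite_set F ->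
  finite_set [set C | cut_ends C `<=` F].
Proof.
move=> Fx finF.
have /choice[f fP] : forall B : {fset X}, exists C,
    (exists2 C', cut_ends C' `<=` F & C' `&` F = [set` B]) ->
    cut_ends C `<=` F /\ C `&` F = [set` B].
  move=> B; have [[C CF CB]|nC] := pselect (exists2 C',
    cut_ends C' `<=` F & C' `&` F = [set` B]); first by exists C.
  by exists set0 => /nC.
apply: sub_finite_set (finite_image f (finite_fset (fpowerset (fset_set F)))).
move=> C CF; exists (fset_set (C `&` F)).
  rewrite /= fpowersetE -fset_set_sub //; last exact: finite_setIr.
have CFE : C `&` F = [set` fset_set (C `&` F)].
  by rewrite fset_setK //; exact: finite_setIr.
have [|CF' CE] := fP (fset_set (C `&` F)); first by exists C.
by apply: (cut_trace_inj Fx) => //; rewrite CE -CFE.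
Qed.

Hypothesis lf : forall v, finite_set [set w | adjacent v w].

Lemma finite_cut_ends C : finite_set (bdry C) -> finite_set (cut_ends C).
Proof. by move=> finC; rewrite finite_setU; split=> //; exact: finite_bdryC. Qed.

Lemma near_finite n x : finite_set (near n x).
Proof.
elim: n => [|n IH]; first by apply: sub_finite_set (finite_set1 x) => y /= ->.
apply: (@sub_finite_set _ _ (near n x `|`
  \bigcup_(u in near n x) [set w | adjacent u w])).
  by move=> y [|[u xu uy]]; [left|right; exists u].
by rewrite finite_setU; split=> //; exact: bigcup_finite.
Qed.

(** An infinite [Y] would contain a ray, which belongs to one of the two ends and would drag a tail
    of [r] or [s] into [Y]. *)
Lemma endless_finite r s Y : is_ray r -> is_ray s ->
  (forall t, is_ray t -> eqv t r \/ eqv t s) ->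
  finite_set (bdry Y) -> eventually_in r (~` Y) -> eventually_in s (~` Y) ->
  finite_set Y.
Proof.
move=> rr sr ends_rs finY rY sY; apply: contrapT => infY.
have [t [tr tY]] := infinite_ray lf conn infY finY.
have tevY : eventually_in t Y by exists 0%N.
case: (ends_rs t tr) => et.
  exact: eventually_in_ncontr (eqv_side rr et finY tevY) rY.
exact: eventually_in_ncontr (eqv_side sr et finY tevY) sY.
Qed.

Lemma reach_component Z a x : reach Z a x -> reach [set y | reach Z a y] a x.
Proof.
move=> ax; have aa := reach_refl (reach_l ax).
suff key b c : reach Z b c -> reach Z a b -> reach [set y | reach Z a y] b c.
  exact: key.
elim=> [{}b _ ab|{}b d {}c Zb bd dc IH ab]; first exact: reach_refl.
apply: (reach_step _ bd) => //; apply: IH; apply: (reach_trans ab).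
by apply: reach_adj bd => //; exact: reach_l dc.
Qed.

Lemma conn_component Z a : conn_set [set y | reach Z a y].
Proof.
move=> x y /reach_component ax /reach_component; apply: reach_trans.
exact: reach_sym.
Qed.

(* A1 is the component containing a tail of r; filling in all components of its
   complement but the one containing a tail of s makes both sides connected. *)
Lemma connected_cut r s : is_ray r -> is_ray s -> ~ eqv r s ->
  exists A, [/\ separates r s A, conn_set A & conn_set (~` A)].
Proof.
move=> rr sr nrs; have [A0 [finA0 [n rA0] sA0]] := separates_exists rr nrs.
pose A1 := [set x | reach A0 (r n) x].
have rA1 m : (n <= m)%N -> A1 (r m) by move=> nm; exact: ray_segment nm.
have [m sA1] : eventually_in s (~` A1).
  by apply: eventually_inS sA0 => x nAx /reach_r.
have finA1 : finite_set (bdry A1).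
  exact: sub_finite_set (@bdry_component _ _ _) finA0.
pose E := [set x | reach (~` A1) (s m) x].
exists (~` E); rewrite setCK; split; last exact: conn_component.
  split.
  - apply: finite_bdryC => //; apply: sub_finite_set (@bdry_component _ _ _) _.
    exact: finite_bdryC.
  - by exists n => k /rA1 A1k /reach_r.
  - by exists m => k mk; rewrite setCK; exact: ray_segment mk.
have A1E : A1 `<=` ~` E by move=> x A1x /reach_r.
(* The walk is stopped on reaching [A1]. Before that it cannot enter [E], a whole component of the
   complement of [A1]. *)
have toA1 x z : reach setT x z -> A1 z -> ~ E x ->
    exists2 w, A1 w & reach (~` E) x w.
  elim=> [{}x _ A1x nEx|{}x y {}z _ xy _ IH A1z nEx].
    by exists x => //; exact: reach_refl.
  have [A1x|nA1x] := pselect (A1 x); first by exists x => //; exact: reach_refl.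
  have nEy : ~ E y.
    move=> Ey; apply: nEx; apply: (reach_trans Ey); apply: reach_adj => //.
      exact: (reach_r Ey).
    exact: adjacent_sym.
  have [w A1w yw] := IH A1z nEy; exists w => //; exact: reach_step nEx xy yw.
have rn x : ~ E x -> reach (~` E) x (r n).
  move=> nEx; have [w A1w xw] := toA1 _ _ (conn x (r n)) (rA1 _ (leqnn n)) nEx.
  apply: (reach_trans xw); apply/reach_sym/(reach_sub A1E); exact: reach_component.
by move=> x y nEx nEy; apply: (reach_trans (rn x nEx)); exact/reach_sym/rn.
Qed.

End Cuts.

Local Open Scope ring_scope.

(** * The height function *)

(** Terms in [B] contribute at least 1, those in [D] at least -1, all others nothing negative. The
    sum reduces to a finite enumeration of the support together with [B]. *)
Lemma ler_fsum_count (T : choiceType) (P D : set T) (B : {fset T}) (f : T -> int) :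
  finite_set [set C | P C /\ f C != 0] -> finite_set D ->
  (forall C, P C -> -1 <= f C) -> (forall C, P C -> ~ D C -> 0 <= f C) ->
  (forall C, C \in B -> [/\ P C, ~ D C & 1 <= f C]) ->
  #|` B|%:Z - #|` fset_set D|%:Z <= \sum_(C \in P) f C.
Proof.
move=> finf finD fN1 f0 fB.
pose S := (fset_set [set C | P C /\ f C != 0] `|` B)%fset.
have SP C : C \in S -> P C.
  by rewrite inE in_fset_set // => /orP[/set_mem[]|/fB[]].
rewrite -(fsbig_widen [set` S]); first last.
- move=> C [PC /= nSC]; apply: contrapT => /eqP fC; apply: nSC.
  by rewrite inE in_fset_set // mem_set.
- by move=> C /SP.
rewrite -fsbig_seq ?fset_uniq //.
have sumS (r : seq T) : (forall C, C \in r -> P C) ->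
    (count (mem B) r)%:Z - (count (mem (fset_set D)) r)%:Z <= \sum_(C <- r) f C.
  elim: r => [|C r IH] rP; first by rewrite big_nil.
  rewrite big_cons /=; have PC := rP _ (mem_head C r).
  have := IH (fun C' C'r => rP _ (mem_behead (s := C :: r) C'r)).
  move: (\sum_(j <- r) f j) (count (mem B) r) (count (mem (fset_set D)) r).
  move=> sr nB nD IHr; have := fN1 _ PC; have := f0 _ PC; have := fB C.
  have [CD|nCD] := pselect (D C); [rewrite [C \in fset_set D]in_fset_set // (mem_set CD)|
    rewrite [C \in fset_set D]in_fset_set // (memNset nCD)]; case: (C \in B).
  - by case.
  - by move=> _ _; lia.
  - by move=> /(_ isT)[_ _] + _ _; lia.
  - by move=> _ /(_ nCD) + _; lia.
apply: le_trans (sumS _ SP).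
have Bcount : (#|` B| <= count (mem B) S)%N.
  rewrite -size_filter; apply: uniq_leq_size; first exact: fset_uniq.
  by move=> C CB; rewrite mem_filter /= CB inE CB orbT.
have Dcount : (count (mem (fset_set D)) S <= #|` fset_set D|)%N.
  rewrite -size_filter; apply: uniq_leq_size; first by rewrite filter_uniq ?fset_uniq.
  by move=> C; rewrite mem_filter /= => /andP[].
lia.
Qed.

Section Height.
Variables (X : digraph) (r s : nat -> X).
Hypotheses (rr : is_ray r) (sr : is_ray s) (nrs : ~ eqv r s).
Hypothesis ends_rs : forall t, is_ray t -> eqv t r \/ eqv t s.
Hypothesis conn : forall x y : X, reach setT x y.
Hypothesis lf : forall v : X, finite_set [set w | adjacent v w].
Hypothesis vtrans : vertex_transitive X.
Variable A : set X.
Hypotheses (Asep : separates r s A) (Aconn : conn_set A) (Acoconn : conn_set (~` A)).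
Implicit Types (C : set X) (g : aut X) (u v w x y z o : X).

(* The translates of the cut {A, ~A}, each given by its side containing a tail
   of r. *)
Definition cut_family : set (set X) :=
  [set C | (exists g, C = g @^-1` A \/ C = ~` (g @^-1` A)) /\ eventually_in r C].

Lemma cut_family_conn C : cut_family C -> conn_set C.
Proof.
move=> [[g [->|->]] _]; first exact: aut_conn_set.
exact: (@aut_conn_set _ g (~` A)).
Qed.

Lemma cut_family_coconn C : cut_family C -> conn_set (~` C).
Proof.
move=> [[g [->|->]] _]; first exact: (@aut_conn_set _ g (~` A)).
by rewrite setCK; exact: aut_conn_set.
Qed.

Lemma cut_ends_finite : finite_set (cut_ends A).
Proof. by apply: finite_cut_ends => //; case: Asep. Qed.

Lemma cut_family_ends C : cut_family C -> exists g, cut_ends C = g @^-1` cut_ends A.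
Proof.
by move=> [[g CA] _]; exists g; case: CA => ->; rewrite ?cut_endsC cut_ends_preimage.
Qed.

Lemma cut_family_finite C : cut_family C -> finite_set (cut_ends C).
Proof.
by move=> /cut_family_ends[g ->]; apply: finite_aut_preimage; exact: cut_ends_finite.
Qed.

Lemma separates_C t t' C : finite_set (cut_ends C) -> separates t t' C ->
  separates t' t (~` C).
Proof.
rewrite finite_setU => -[fin1 fin2] [_ tC t'C]; split=> //.
by rewrite setCK.
Qed.

Lemma preimage_separates g :
  separates r s (g @^-1` A) \/ separates s r (g @^-1` A).
Proof.
have rg := aut_ray g rr; have sg := aut_ray g sr; have [finA _ _] := Asep.
have fin : finite_set (bdry (g @^-1` A)).
  by rewrite bdry_preimage; exact: finite_aut_preimage.
case: (aut_ends rr sr nrs ends_rs g) => -[er es]; [left|right].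
  by have [] := separates_eqv sr rg sg er es Asep.
by have [] := separates_eqv sr sg rg er es Asep.
Qed.

Lemma cut_family_separates C : cut_family C -> separates r s C.
Proof.
move=> CF; have finC := cut_family_finite CF.
case: CF => -[g CA] rC; case: CA => CA; have := preimage_separates g.
  by rewrite -CA => -[//|[_ _ /(eventually_in_ncontr rC)]].
have -> : g @^-1` A = ~` C by rewrite CA setCK.
case=> [[_ /(eventually_in_ncontr rC)]//|].
by move=> /separates_C; rewrite cut_endsC setCK; apply.
Qed.

Lemma cut_family_ev_s C : cut_family C -> eventually_in s (~` C).
Proof. by case/cut_family_separates. Qed.

Lemma cut_family_exists g :
  exists2 C, cut_family C & cut_ends C = g @^-1` cut_ends A.
Proof.
case: (preimage_separates g) => -[_ rA sA].
  by exists (g @^-1` A); [split=> //; exists g; left|exact: cut_ends_preimage].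
exists (~` (g @^-1` A)); last by rewrite cut_endsC cut_ends_preimage.
by split=> //; exists g; right.
Qed.

Lemma cut_family_preimage g C : eqv r (g \o r) ->
  cut_family C -> cut_family (g @^-1` C).
Proof.
move=> er CF; split.
  case: CF => -[h [->|->]] _; exists (h * g)%g; [left|right] => //.
have [finb rC _] := cut_family_separates CF.
exact: (eqv_side (aut_ray g rr) er finb rC).
Qed.

Lemma cut_family_preimageC g C : eqv s (g \o r) ->
  cut_family C -> cut_family (~` (g @^-1` C)).
Proof.
move=> er CF; have finC := cut_family_finite CF; split.
  case: CF => -[h [->|->]] _; exists (h * g)%g; [right|left] => //.
  by rewrite -preimage_setC setCK.
have [] := separates_C finC (cut_family_separates CF) => finb sC _.
exact: (eqv_side (aut_ray g rr) er finb sC).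
Qed.

(** The ends of each cut form a translate of [cut_ends A], of bounded diameter. If they meet [P]
    they lie in a fixed ball: [n] steps reach [P], [R] more the translated base point, and [R] more
    any other end. *)
Lemma cut_family_meet_finite (P : set X) : finite_set P ->
  finite_set [set C | cut_family C /\ cut_ends C `&` P !=set0].
Proof.
move=> finP; pose o := r 0%N.
have [R AR] := finite_near conn o cut_ends_finite.
have [n Pn] := finite_near conn o finP.
apply: sub_finite_set (finite_cuts conn (near_refl (n + R + R) o)
  (near_finite lf (n + R + R) o)).
move=> C [/cut_family_ends[g Cg] [x [Cx Px]]] y Cy; rewrite Cg in Cx Cy.
have gx z : cut_ends A (g z) -> near R ((g^-1)%g o) z.
  by move=> /AR /(aut_near (g^-1)%g); rewrite autK.
apply: near_trans (gx _ Cy); apply: near_trans (Pn _ Px) _.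
exact/near_sym/gx.
Qed.

Definition chi C x : int := (`[< C x >] : nat)%:Z.

Definition rise v w : int := \sum_(C \in cut_family) (chi C w - chi C v).

(** A cut separating [v] from [w] has an end on any fixed path between them. *)
Lemma rise_support v w :
  finite_set [set C | cut_family C /\ chi C w - chi C v != 0].
Proof.
have [P finP vw] : exists2 P, finite_set P & reach P v w.
  have [n [p [pP <- <- _]]] := reach_path (conn v w).
  exists (p @` `I_n.+1); first exact/finite_image/finite_II.
  by apply: path_reach => // i ni; exists i.
apply: sub_finite_set (cut_family_meet_finite finP) => C [CF Cvw]; split=> //.
apply: contrapT => CP.
have nCP z : P z -> ~ cut_ends C z by move=> Pz Cz; apply: CP; exists z.
move: Cvw; rewrite /chi (_ : C w = C v) ?subrr ?eqxx //.
apply/propext; split=> [Cw|Cv]; last exact: reach_cut vw Cv nCP.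
exact: reach_cut (reach_sym vw) Cw nCP.
Qed.

Lemma rise_finite (D : set (set X)) v w : D `<=` cut_family ->
  [set C | cut_family C /\ chi C w - chi C v != 0] `<=` D ->
  rise v w = \sum_(C \in D) (chi C w - chi C v).
Proof.
move=> DF vwD; apply/esym/fsbig_widen => // C [CF nDC] /=.
by apply: contrapT => /eqP nz; apply: nDC; exact: vwD.
Qed.

Lemma riseD u v w : rise u w = rise u v + rise v w.
Proof.
(* All three sums are restricted to one finite index set, where they add termwise. *)
pose D := [set C | cut_family C /\ chi C w - chi C u != 0] `|`
  ([set C | cut_family C /\ chi C v - chi C u != 0] `|`
   [set C | cut_family C /\ chi C w - chi C v != 0]).
have finD : finite_set D.
  by rewrite !finite_setU; split; [|split]; exact: rise_support.
have DF : D `<=` cut_family by move=> C [[]|[[]|[]]].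
rewrite (@rise_finite D u w) //; last by move=> C; left.
rewrite (@rise_finite D u v) //; last by move=> C; right; left.
rewrite (@rise_finite D v w) //; last by move=> C; right; right.
by rewrite -fsbig_split //; apply: eq_fsbigr => C _ /=; ring.
Qed.

Lemma rise_preserving g v w : eqv r (g \o r) -> eqv s (g \o s) ->
  rise (g v) (g w) = rise v w.
Proof.
move=> er es; rewrite /rise.
rewrite [RHS](reindex_fsbig (fun C => g @^-1` C) cut_family) //.
split=> [C|C C' _ _ CC'|C CF]; first exact: cut_family_preimage.
- apply/seteqP; split=> x; rewrite -[x](autKV g).
    by rewrite -[C _]/((g @^-1` C) _) CC'.
  by rewrite -[C' _]/((g @^-1` C') _) -CC'.
exists ((g^-1)%g @^-1` C).
  apply: cut_family_preimage => //; apply: eqv_sym.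
  have := aut_eqv (g^-1)%g er; congr eqv; apply/funext => n /=.
  by rewrite autK.
by apply/seteqP; split=> x; rewrite /= autK.
Qed.

(** When [g] swaps the ends, the preimage of a cut must be complemented to return to the family,
    which changes the sign of each term. *)
Lemma rise_reversing g v w : eqv r (g \o s) -> eqv s (g \o r) ->
  rise (g v) (g w) = - rise v w.
Proof.
move=> er es; rewrite /rise.
rewrite [in RHS](reindex_fsbig (fun C => ~` (g @^-1` C)) cut_family) //; last first.
  split=> [C|C C' _ _ /(congr1 setC)|C CF]; first exact: cut_family_preimageC.
  - rewrite !setCK => CC'; apply/seteqP; split=> x; rewrite -[x](autKV g).
      by rewrite -[C _]/((g @^-1` C) _) CC'.
    by rewrite -[C' _]/((g @^-1` C') _) -CC'.
  exists (~` ((g^-1)%g @^-1` C)).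
    apply: cut_family_preimageC => //; apply: eqv_sym.
    have := aut_eqv (g^-1)%g er; congr eqv; apply/funext => n /=.
    by rewrite autK.
  by apply/seteqP; split=> x; rewrite /= autK; [exact: contrapT|by move=> Cx; apply].
rewrite -mulN1r mulr_fsumr; apply: eq_fsbigr => C _.
rewrite /chi /= !asbool_neg.
by case: `[< C (g v) >]; case: `[< C (g w) >].
Qed.


(* Otherwise ~C would be connected, avoid the ends of A and meet A, so it would
   lie in A although it contains a tail of s. *)
Lemma cut_family_up R o C w : cut_ends A `<=` near R o ->
  (forall z, near R o z -> ~ cut_ends C z) -> cut_family C ->
  A w -> C o -> C w.
Proof.
move=> AR RC CF Aw Co; apply: contrapT => nCw.
have nearC := conn_set_sub (@conn_set_near _ R o) (near_refl R o) Co RC.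
have CA : ~` C `<=` A.
  by apply: (conn_set_sub (cut_family_coconn CF) nCw Aw) => z nCz /AR /nearC.
have [_ _ sA] := Asep.
exact: (eventually_in_ncontr (eventually_inS CA (cut_family_ev_s CF)) sA).
Qed.

(** Mirror image of [cut_family_up]: otherwise the connected set [C] would avoid the ends of [A] and
    lie outside [A], although it contains a tail of [r]. *)
Lemma cut_family_down R o C w : cut_ends A `<=` near R o ->
  (forall z, near R o z -> ~ cut_ends C z) -> cut_family C ->
  ~ A w -> C w -> C o.
Proof.
move=> AR RC CF nAw Cw; apply: contrapT => nCo.
have nearC : near R o `<=` ~` C.
  by apply: (conn_set_sub (@conn_set_near _ R o) (near_refl R o) nCo); rewrite cut_endsC.
have CA : C `<=` ~` A.
  apply: (conn_set_sub (cut_family_conn CF) Cw nAw) => z Cz.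
  by rewrite cut_endsC => /AR /nearC.
have [_ rA _] := Asep; case: CF => _ rC.
exact: (eventually_in_ncontr rA (eventually_inS CA rC)).
Qed.

Lemma cut_family_at x : exists2 C, cut_family C & cut_ends C x.
Proof.
have [y [a [_ Aa _]]] := separates_bdry_edge conn Asep.
have [g gx] := vtrans x a; have [C CF Cg] := cut_family_exists g.
by exists C => //; rewrite Cg /= gx; left.
Qed.

(** Otherwise take [r n] in [A], off [cut_ends A] and off the ends of all cuts that miss [o] or have
    an end near [o]. A cut [C] with an end at [r n] then contains the ball about [o], so its
    complement lies outside [A]; a neighbour of [r n] outside [C] makes [r n] an end of [A]. *)
Lemma cut_family_infinite_above o : infinite_set [set C | cut_family C /\ ~ C o].
Proof.
move=> finN; have [R AR] := finite_near conn o cut_ends_finite.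
pose N := [set C | cut_family C /\ ~ C o] `|`
  [set C | cut_family C /\ cut_ends C `&` near R o !=set0].
have finU : finite_set (\bigcup_(C in N) cut_ends C `|` cut_ends A).
  rewrite finite_setU; split; last exact: cut_ends_finite.
  apply: bigcup_finite => [|C [] [/cut_family_finite] //].
  by rewrite finite_setU; split=> //; apply/cut_family_meet_finite/near_finite.
have [_ rA sA] := Asep.
have [n /(_ n (leqnn n))[Arn nUrn]] := eventually_inI rA (ray_avoids rr finU).
have [C CF Crn] := cut_family_at (r n).
have nNC : ~ N C by move=> NC; apply: nUrn; left; exists C.
have Co : C o by apply: contrapT => nCo; apply: nNC; left.
have RC z : near R o z -> ~ cut_ends C z.
  by move=> Rz Cz; apply: nNC; right; split=> //; exists z.
have nearC := conn_set_sub (@conn_set_near _ R o) (near_refl R o) Co RC.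
have [m /(_ m (leqnn m))[nAsm nCsm]] := eventually_inI sA (cut_family_ev_s CF).
have CA : ~` C `<=` ~` A.
  apply: (conn_set_sub (cut_family_coconn CF) nCsm nAsm) => z nCz.
  by rewrite cut_endsC => /AR /nearC.
have Crn' : C (r n) by apply: contrapT => /CA.
have [y nCy rny] := cut_ends_nbr Crn' Crn.
by apply: nUrn; right; case: (cut_endsP rny Arn (CA _ nCy)).
Qed.

(** The same argument along [s], with the sides exchanged. *)
Lemma cut_family_infinite_below o : infinite_set [set C | cut_family C /\ C o].
Proof.
move=> finN; have [R AR] := finite_near conn o cut_ends_finite.
pose N := [set C | cut_family C /\ C o] `|`
  [set C | cut_family C /\ cut_ends C `&` near R o !=set0].
have finU : finite_set (\bigcup_(C in N) cut_ends C `|` cut_ends A).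
  rewrite finite_setU; split; last exact: cut_ends_finite.
  apply: bigcup_finite => [|C [] [/cut_family_finite] //].
  by rewrite finite_setU; split=> //; apply/cut_family_meet_finite/near_finite.
have [_ rA sA] := Asep.
have [n /(_ n (leqnn n))[nAsn nUsn]] := eventually_inI sA (ray_avoids sr finU).
have [C CF Csn] := cut_family_at (s n).
have nNC : ~ N C by move=> NC; apply: nUsn; left; exists C.
have nCo : ~ C o by move=> Co; apply: nNC; left.
have nearC : near R o `<=` ~` C.
  apply: (conn_set_sub (@conn_set_near _ R o) (near_refl R o) nCo) => z Rz.
  by rewrite cut_endsC => Cz; apply: nNC; right; split=> //; exists z.
have [_ rC _] := cut_family_separates CF.
have [m /(_ m (leqnn m))[Arm Crm]] := eventually_inI rA rC.
have CA : C `<=` A.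
  by apply: (conn_set_sub (cut_family_conn CF) Crm Arm) => z Cz /AR /nearC.
have nCsn : (~` C) (s n) by move=> /CA.
rewrite -cut_endsC in Csn.
have [y /contrapT Cy sny] := cut_ends_nbr nCsn Csn.
by apply: nUsn; right; case: (cut_endsP (adjacent_sym sny) (CA _ Cy) nAsn).
Qed.

(** The difference misses tails of both rays and has finite boundary. *)
Lemma cut_family_above_finite C : cut_family C -> finite_set (A `\` C).
Proof.
move=> CF; have [finC rC _] := cut_family_separates CF.
have [finA _ sA] := Asep; have finC' := cut_family_finite CF.
apply: (endless_finite conn lf rr sr ends_rs).
- apply: sub_finite_set (@bdryI _ _ _) _; rewrite finite_setU; split=> //.
  by move: finC'; rewrite finite_setU => -[].
- by apply: eventually_inS rC => x Cx [].
- by apply: eventually_inS sA => x nAx [].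
Qed.

Lemma cut_family_below_finite C : cut_family C -> finite_set (C `\` A).
Proof.
move=> CF; have [finC rC sC] := cut_family_separates CF.
have [finA rA sA] := Asep.
apply: (endless_finite conn lf rr sr ends_rs).
- apply: sub_finite_set (@bdryI _ _ _) _; rewrite finite_setU; split=> //.
  exact: finite_bdryC.
- by apply: eventually_inS rA => x Ax [].
- by apply: eventually_inS sC => x nCx [].
Qed.

Lemma chi_cases C v w : [\/ chi C w - chi C v = 0 /\ (C v <-> C w),
  chi C w - chi C v = 1 /\ (~ C v /\ C w) |
  chi C w - chi C v = -1 /\ (C v /\ ~ C w)].
Proof.
rewrite /chi; case: asboolP => Cw; case: asboolP => Cv.
- by constructor 1.
- by constructor 2.
- by constructor 3.
- by constructor 1.
Qed.

(** Choose more than [|m|] plus the size of [D] cuts missing [o] and having no end near it. All but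
    finitely many vertices of [A] lie in all of these, while by [cut_family_up] only cuts in [D] can
    contribute -1, so the rise exceeds [m]. *)
Lemma rise_above_finite o (m : int) : finite_set [set w | A w /\ rise o w <= m].
Proof.
apply: contrapT => infL; have [R AR] := finite_near conn o cut_ends_finite.
pose D := [set C | cut_family C /\ cut_ends C `&` near R o !=set0].
have finD : finite_set D by apply/cut_family_meet_finite/near_finite.
have [B BP Bsize] := infinite_set_fset (`|m| + #|` fset_set D|).+1
  (infinite_setD (@cut_family_infinite_above o) finD).
have finU : finite_set (\bigcup_(C in [set` B]) (A `\` C)).
  by apply: bigcup_finite => // C /BP[[CF _] _]; exact: cut_family_above_finite.
have [w [Aw wm] BCw] : exists2 w, A w /\ rise o w <= m & forall C, C \in B -> C w.
  apply: contrapT => nw; apply: infL; apply: sub_finite_set finU => w [Aw wm].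
  apply: contrapT => nU; apply: nw; exists w => // C CB.
  by apply: contrapT => nCw; apply: nU; exists C.
have : #|` B|%:Z - #|` fset_set D|%:Z <= rise o w.
  apply: ler_fsum_count => //; first exact: rise_support.
  - by move=> C _; case: (chi_cases C o w) => -[-> _].
  - move=> C CF nDC; case: (chi_cases C o w) => -[-> //] [Co nCw].
    case: nCw; apply: (cut_family_up AR _ CF Aw Co) => z Rz Cz.
    by apply: nDC; split=> //; exists z.
  - move=> C CB; have [[CF nCo] nDC] := BP _ CB; have Cw := BCw _ CB.
    split=> //; case: (chi_cases C o w) => -[-> //]; last by case.
    by move=> /iffRL/(_ Cw).
lia.
Qed.

Lemma rise_below_finite o (m : int) : finite_set [set w | ~ A w /\ m <= rise o w].
Proof.
apply: contrapT => infL; have [R AR] := finite_near conn o cut_ends_finite.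
pose D := [set C | cut_family C /\ cut_ends C `&` near R o !=set0].
have finD : finite_set D by apply/cut_family_meet_finite/near_finite.
have [B BP Bsize] := infinite_set_fset (`|m| + #|` fset_set D|).+1
  (infinite_setD (@cut_family_infinite_below o) finD).
have finU : finite_set (\bigcup_(C in [set` B]) (C `\` A)).
  by apply: bigcup_finite => // C /BP[[CF _] _]; exact: cut_family_below_finite.
have [w [nAw wm] BCw] : exists2 w, ~ A w /\ m <= rise o w & forall C, C \in B -> ~ C w.
  apply: contrapT => nw; apply: infL; apply: sub_finite_set finU => w [nAw wm].
  apply: contrapT => nU; apply: nw; exists w => // C CB.
  by move=> Cw; apply: nU; exists C.
have : #|` B|%:Z - #|` fset_set D|%:Z <= rise w o.
  apply: ler_fsum_count => //; first exact: rise_support.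
  - by move=> C _; case: (chi_cases C w o) => -[-> _].
  - move=> C CF nDC; case: (chi_cases C w o) => -[-> //] [Cw nCo].
    case: nCo; apply: (cut_family_down AR _ CF nAw Cw) => z Rz Cz.
    by apply: nDC; split=> //; exists z.
  - move=> C CB; have [[CF Co] nDC] := BP _ CB; have nCw := BCw _ CB.
    split=> //; case: (chi_cases C w o) => -[-> //]; last by case.
    by move=> /iffRL/(_ Co).
(* Additivity gives [rise o o = 0], hence [rise w o = - rise o w]. *)
have := riseD o w o; have := riseD o o o; lia.
Qed.

Lemma rise_level_finite o (m : int) : finite_set [set w | rise o w = m].
Proof.
have fin := conj (rise_above_finite o m) (rise_below_finite o m).
rewrite -finite_setU in fin; apply: sub_finite_set fin => w /= <-.
by have [Aw|nAw] := pselect (A w); [left|right].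
Qed.

End Height.

Lemma height_exists (X : digraph) : vertex_transitive X -> arc_transitive X ->
  two_ended X ->
  exists phi : X -> int, (forall m, finite_set [set w | phi w = m]) /\
    forall g : aut X, exists e : bool, forall v w,
      phi (g w) - phi (g v) = (-1) ^+ e * (phi w - phi v).
Proof.
move=> vtrans atrans ends2; have conn := connected_reach ends2.1.
have [r [s [rr sr nrs ends_rs]]] := two_ended_rays ends2.
have lf := locally_finite rr sr nrs ends_rs conn vtrans atrans.
have [A [Asep Aconn Acoconn]] := connected_cut conn lf rr sr nrs.
pose rise0 := rise r A; pose o := r 0%N.
have rise0D u v w : rise0 u w = rise0 u v + rise0 v w.
  exact: (@riseD _ r s).
exists (rise0 o); split=> [m|g].
  exact: (@rise_level_finite _ r s).
have riseB v w : rise0 o w - rise0 o v = rise0 v w by rewrite (rise0D o v w); ring.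
case: (aut_ends rr sr nrs ends_rs g) => -[er es]; [exists false|exists true] => v w;
  rewrite !riseB ?expr0 ?expr1 ?mul1r ?mulN1r.
  exact: (@rise_preserving _ r s).
exact: (@rise_reversing _ r s).
Qed.


Lemma two_ended_infinite (X : digraph) : two_ended X -> infinite_set [set: X].
Proof.
move=> /two_ended_rays[r [s [[rinj _] _ _ _]]] fin.
by have [n /(_ n (leqnn n))] := injective_avoids_finite rinj fin; apply.
Qed.

(** Each automorphism acts on levels as an isometry of the integers; using differences leaves its
    translation part implicit. *)
Definition affine_on (X : digraph) (psi : X -> int) := forall g : aut X,
  exists e : bool, forall v w, psi (g w) - psi (g v) = (-1) ^+ e * (psi w - psi v).

(** * Level subgroups *)

(** Every arc changes the height by [c] or [-c], so by connectedness all height differences are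
    multiples of [c] and can be divided by it. *)
Lemma grading_exists (X : digraph) : vertex_transitive X -> arc_transitive X ->
  two_ended X -> exists psi : X -> int,
  [/\ forall m, finite_set [set w | psi w = m], affine_on psi &
    forall v w, arc v w -> psi w = psi v + 1 \/ psi w = psi v - 1].
Proof.
move=> vtrans atrans ends2; have infX := two_ended_infinite ends2.
have conn := connected_reach ends2.1.
have [phi [phi_fin phi_aut]] := height_exists vtrans atrans ends2.
have [o _] := infinite_setN0 infX.
have [v0 [w0 vw0]] : exists v w : X, arc v w.
  apply: contrapT => noarc; apply: infX; apply: sub_finite_set (finite_set1 o).
  move=> y _ /=; case: (conn y o) => // x y' z _ [xy|yx]; case: noarc.
    by exists x, y'.
  by exists y', x.
pose c := phi w0 - phi v0.
have phi_arc v w : arc v w -> phi w - phi v = c \/ phi w - phi v = - c.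
  move=> vw; have [g [<- <-]] := atrans _ _ _ _ vw0 vw.
  have [e ->] := phi_aut g; rewrite -/c.
  by case: e; [right; rewrite expr1 mulN1r|left; rewrite mul1r].
have phi_mult v : exists k, phi v - phi o = c * k.
  elim: (conn v o) => [x _|x y z _ xy _ [k IH]]; first by exists 0; rewrite subrr mulr0.
  case: xy => /phi_arc[] E; [exists (k - 1)|exists (k + 1)|exists (k + 1)|exists (k - 1)];
    by rewrite mulrDr -IH ?mulrN mulr1 -?E; lia.
(* With [c = 0] the height would be constant and its only level infinite. *)
have c0 : c != 0.
  apply/eqP => c0; apply: infX; apply: sub_finite_set (phi_fin (phi o)) => v _ /=.
  by have [k /eqP] := phi_mult v; rewrite c0 mul0r subr_eq0 => /eqP.
have /choice[psi psiE] := phi_mult.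
have psiB v w : c * (psi w - psi v) = phi w - phi v.
  by rewrite mulrBr -!psiE; lia.
have cI := mulfI c0.
exists psi; split.
- move=> m; apply: sub_finite_set (phi_fin (phi o + c * m)) => v /= <-.
  by rewrite -psiE; lia.
- move=> g; have [e eP] := phi_aut g; exists e => v w; apply: cI.
  by rewrite psiB eP -psiB; ring.
- move=> v w /phi_arc[]; rewrite -psiB => E; [left|right].
    by apply/eqP; rewrite addrC -subr_eq; apply/eqP/cI; rewrite E mulr1.
  by apply/eqP; rewrite addrC -subr_eq; apply/eqP/cI; rewrite E mulrN1.
Qed.

(** The first isomorphism theorem; [F] evaluates [f] at a chosen representative. *)
Lemma quotient_group_iso (G H : groupType) (N : normalSubgroup G) (f : G -> H) :
  (forall x y, f (x * y)%g = (f x * f y)%g) -> (forall h, exists x, f x = h) ->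
  (forall x, nsub_set N x <-> f x = 1%g) -> group_isomorphic (quotient_group N) H.
Proof.
move=> fM fsurj fker; have f1 : f 1%g = 1%g by apply/fker/nsub1.
have fV x : f (x^-1)%g = ((f x)^-1)%g.
  by apply: (@mulgI _ (f x)); rewrite -fM !mulgV.
pose F (B : quotient_group N) : H := f (projT1 (cid (cosetP B))).
have Fcoset x : F (coset N x) = f x.
  rewrite /F; case: cid => y /= /(congr1 val) /= xy.
  have : lcoset_set N y y by exists 1%g; [exact: nsub1|rewrite mulg1].
  by rewrite -xy => -[n /fker fn <-]; rewrite fM fn mulg1.
have FM : {morph F : A B / (A * B)%g}.
  move=> A B; have [x ->] := cosetP A; have [y ->] := cosetP B.
  by rewrite -[(_ * _)%g]/(coset_mul _ _) coset_mulE !Fcoset fM.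
pose mF := isMultiplicative.Build _ _ F FM.
exists (HB.pack_for {multiplicative quotient_group N -> H} F mF).
rewrite -setTT_bijective; split=> //= [A B _ _|h _].
  have [x ->] := cosetP A; have [y ->] := cosetP B.
  rewrite !Fcoset => fxy; apply: val_inj => /=.
  have Nxy : nsub_set N (x^-1 * y)%g by apply/fker; rewrite fM fV fxy mulVg.
  apply/seteqP; split=> z [n Nn <-].
    exists ((x^-1 * y)^-1 * n)%g; last by rewrite invgM invgK !mulgA mulgV mul1g.
    by apply: nsubM => //; exact: nsubV.
  by exists ((x^-1 * y) * n)%g; [exact: nsubM|rewrite !mulgA mulgV mul1g].
by have [x <-] := fsurj h; exists (coset N x).
Qed.

Section LevelSubgroup.
Variables (X : digraph) (psi : X -> int).
Hypothesis psi_aut : affine_on psi.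

Lemma affine_eq (g : aut X) v w : psi (g v) = psi (g w) <-> psi v = psi w.
Proof.
have [e eP] := psi_aut g.
split=> E; move: (eP v w); rewrite E subrr; last by rewrite mulr0; lia.
by case: {eP} e; rewrite ?expr1 ?expr0; lia.
Qed.

Lemma level_group_closed :
  group_closed (mem [set g : aut X | forall v, psi (g v) = psi v]).
Proof.
split=> [|g h]; first by apply/mem_set.
move=> /set_mem gP /set_mem hP; apply/mem_set => v /=.
by rewrite gP -[in RHS](autKV h v) hP.
Qed.

Lemma level_group_normal (x g : aut X) : (forall v, psi (x v) = psi v) ->
  forall v, psi ((x ^ g)%g v) = psi v.
Proof.
move=> xP v; apply/(affine_eq g).
by rewrite -[g _]/(g ((g^-1)%g (x (g v)))) autKV xP.
Qed.

Definition level_subgroup : normalSubgroup (aut X) :=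
  NormalSubgroup level_group_closed level_group_normal.

Hypothesis level_trans : forall v w, psi v = psi w ->
  exists2 g, nsub_set level_subgroup g & g v = w.

Lemma orbit_level v w : orbit level_subgroup v w <-> psi v = psi w.
Proof.
split=> [[g gN <-]|/level_trans[g gN <-]]; first by rewrite gN.
by exists g.
Qed.

Lemma level_finite_orbits : (forall m, finite_set [set w | psi w = m]) ->
  finite_orbits level_subgroup.
Proof. by move=> fin v; apply: sub_finite_set (fin (psi v)) => w /orbit_level. Qed.

Lemma quotient_level_iso (R : int -> int -> Prop) :
  (forall i, exists v, psi v = i) ->
  (forall i j, R i j <-> exists v w, [/\ psi v = i, psi w = j & arc v w]) ->
  digraph_isomorphic (quotient_digraph level_subgroup) (@Digraph int R).
Proof.
move=> psi_surj RP.
have blockP (B : quotient_digraph level_subgroup) :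
    exists i, forall v, \val B v <-> psi v = i.
  have [v _ Bv] := set_mem (valP B); exists (psi v) => w.
  by rewrite -Bv orbit_level; split.
have [f fP] := choice blockP.
exists f; split.
  rewrite -setTT_bijective; split=> // [B C _ _ fBC|i _].
    apply: val_inj; apply/seteqP; split=> v.
      by move=> /fP; rewrite fBC => /fP.
    by move=> /fP; rewrite -fBC => /fP.
  have [v vi] := psi_surj i.
  exists (SigSub (mem_set (imageT (orbit level_subgroup) v))) => //.
  by rewrite -vi; apply/esym/fP; exists 1%g => //; exact: nsub1.
move=> B C; split=> [[v [w [/fP Bv /fP Cw vw]]]|/RP[v [w [/fP Bv /fP Cw vw]]]].
  by apply/RP; exists v, w.
by exists v, w.
Qed.

End LevelSubgroup.


(** * From a grading with unit steps to the cyclic or dihedral quotient *)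

Section Graded.
Variables (X : digraph) (psi : X -> int).
Hypothesis psi_fin : forall m, finite_set [set w | psi w = m].
Hypothesis psi_aut : affine_on psi.
Hypothesis psi_arc : forall v w, arc v w -> psi w = psi v + 1 \/ psi w = psi v - 1.
Hypotheses (vtrans : vertex_transitive X) (atrans : arc_transitive X).
Hypothesis conn : forall x y : X, reach setT x y.
Hypothesis infX : infinite_set [set: X].

Lemma psi_adj v w : adjacent v w -> psi w = psi v + 1 \/ psi w = psi v - 1.
Proof. by case=> /psi_arc[]; [left|right|right|left]; lia. Qed.

Definition all_nbrs (d : int) v := forall w, adjacent v w -> psi w = psi v + d.

(* Otherwise the vertices would alternate between two levels. *)
Lemma not_one_sided v : ~ (all_nbrs 1 v \/ all_nbrs (-1) v).
Proof.
move=> v1; apply: infX.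
have one_sided w : all_nbrs 1 w \/ all_nbrs (-1) w.
  have [g gw] := vtrans w v; have [e eP] := psi_aut g.
  have dual d : all_nbrs d v -> all_nbrs ((-1) ^+ e * d) w.
    move=> vd u wu; have := vd (g u); rewrite -gw aut_adj => /(_ wu) gu.
    by have := eP w u; case: e {eP} => /=; rewrite ?expr0 ?expr1; lia.
  by move: dual; case: e {eP} => dual; case: v1 => /dual;
    rewrite ?expr1 ?expr0 ?mulrNN ?mul1r ?mulr1; [right|left|left|right].
have [d vd d1] : exists2 d : int, all_nbrs d v & d = 1 \/ d = - 1.
  by case: v1; [exists 1|exists (-1)] => //; [left|right].
have fin2 := conj (psi_fin (psi v)) (psi_fin (psi v + d)).
rewrite -finite_setU in fin2; apply: sub_finite_set fin2 => w _.
suff : (psi w = psi v /\ all_nbrs d w) \/ (psi w = psi v + d /\ all_nbrs (- d) w).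
  by case=> -[]; [left|right].
elim: (reach_sym (conn v w)) vd => [x _ xd|x y z _ xy _ IH zd]; first by left.
have yx := adjacent_sym xy.
have side e : e = 1 \/ e = -1 -> psi y = psi x + e -> all_nbrs e x.
  move=> e1 yE; case: (one_sided x) => xd; have := xd _ xy;
    by case: e1 yE xd => -> //; lia.
case: (IH zd) => -[yz yd]; have xE := yd _ yx; [right|left]; split; try lia.
  by apply: side; [case: d1 => ->; rewrite ?opprK; [right|left]|lia].
by apply: side => //; lia.
Qed.

Lemma up_nbr v : exists2 w, adjacent v w & psi w = psi v + 1.
Proof.
apply: contrapT => nup; apply: (@not_one_sided v); right => w vw.
by case: (psi_adj vw) => // E; case: nup; exists w.
Qed.

Lemma down_nbr v : exists2 w, adjacent v w & psi w = psi v - 1.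
Proof.
apply: contrapT => ndown; apply: (@not_one_sided v); left => w vw.
by case: (psi_adj vw) => // E; case: ndown; exists w.
Qed.

Lemma psi_surj i : exists v, psi v = i.
Proof.
have [o _] := infinite_setN0 infX.
have up n : exists v, psi v = psi o + n%:Z.
  elim: n => [|n [v vn]]; first by exists o; rewrite addr0.
  by have [w _ wv] := up_nbr v; exists w; lia.
have down n : exists v, psi v = psi o - n%:Z.
  elim: n => [|n [v vn]]; first by exists o; rewrite subr0.
  by have [w _ wv] := down_nbr v; exists w; lia.
have [io|io] := lerP (psi o) i.
  by have [v vi] := up `|i - psi o|%N; exists v; lia.
by have [v vi] := down `|i - psi o|%N; exists v; lia.
Qed.

Lemma some_arc : exists v w : X, arc v w.
Proof.
have [o _] := infinite_setN0 infX.
by have [w [ow|wo] _] := up_nbr o; [exists o, w|exists w, o].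
Qed.

Lemma out_nbr (v : X) : exists w, arc v w.
Proof.
have [a [b ab]] := some_arc; have [g <-] := vtrans a v.
by exists (g b); apply/aut_arc.
Qed.

(** Automorphisms preserve arcs, and all arcs rise, so no automorphism reflects the levels: every
    one is a translation. *)
Lemma cyclic_level_subgroup : (forall v w, arc v w -> psi w = psi v + 1) ->
  let N := level_subgroup psi_aut in finite_orbits N /\ cyclic_case N.
Proof.
move=> arc_up N.
have shift (g : aut X) v w : psi (g w) - psi (g v) = psi w - psi v.
  have [e eP] := psi_aut g; have [a [b ab]] := some_arc.
  have gb := arc_up _ _ (iffRL (aut_arc g a b) ab).
  rewrite eP; have := eP a b; rewrite gb (arc_up _ _ ab).
  by case: e {eP}; rewrite ?expr0 ?expr1 ?mul1r //; lia.
have Ntrans v w : psi v = psi w -> exists2 g, nsub_set N g & g v = w.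
  move=> vw; have [g gv] := vtrans v w; exists g => // u.
  by have := shift g v u; rewrite gv; lia.
split; first exact: level_finite_orbits.
split.
  apply: quotient_level_iso => //; first exact: psi_surj.
  move=> i j; split=> [->|[v [w [<- <- /arc_up]]]] //.
  have [v <-] := psi_surj i; have [w vw] := out_nbr v.
  by exists v, w; split=> //; exact: arc_up.
(* With [o] on level 0, [psi (g o)] is the translation length of [g]. *)
have [o o0] := psi_surj 0.
apply: (@quotient_group_iso _ infinite_cyclic _ (fun g : aut X => psi (g o))).
- move=> g h; change (psi (g (h o)) = psi (g o) + psi (h o)).
  by have := shift g o (h o); lia.
- by move=> i; have [v <-] := psi_surj i; have [g <-] := vtrans o v; exists g.
- move=> g; split=> [gN|go v]; first by rewrite gN.
  by have := shift g o v; rewrite o0 [psi (g o)](go : _ = 0 :> int) !subr0.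
Qed.

Definition out_dir d v := exists2 w, arc v w & psi w = psi v + d.
Definition in_dir d v := exists2 u, arc u v & psi u = psi v + d.

Lemma aut_out_dir (g : aut X) (e : bool) d v :
  (forall v w, psi (g w) - psi (g v) = (-1) ^+ e * (psi w - psi v)) ->
  out_dir d v -> out_dir ((-1) ^+ e * d) (g v).
Proof.
move=> eP [w vw wd]; exists (g w); first exact/aut_arc.
by have := eP v w; rewrite wd [psi v + d - _]addrAC subrr add0r; lia.
Qed.

Lemma aut_in_dir (g : aut X) (e : bool) d v :
  (forall v w, psi (g w) - psi (g v) = (-1) ^+ e * (psi w - psi v)) ->
  in_dir d v -> in_dir ((-1) ^+ e * d) (g v).
Proof.
move=> eP [w vw wd]; exists (g w); first exact/aut_arc.
by have := eP v w; rewrite wd [psi v + d - _]addrAC subrr add0r; lia.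
Qed.

Hypothesis arc_up_down : (exists v w, arc v w /\ psi w = psi v + 1) /\
  (exists v w, arc v w /\ psi w = psi v - 1).

(* Otherwise every vertex passes arcs only upwards or only downwards, and by
   connectedness all of them do so in the same direction. *)
Lemma branching : (forall v, out_dir 1 v /\ out_dir (-1) v) \/
  (forall v, in_dir 1 v /\ in_dir (-1) v).
Proof.
have out_all v : out_dir 1 v /\ out_dir (-1) v ->
    forall w, out_dir 1 w /\ out_dir (-1) w.
  move=> [v1 vN1] w; have [g <-] := vtrans v w; have [e eP] := psi_aut g.
  have := aut_out_dir eP v1; have := aut_out_dir eP vN1.
  by case: e {eP}; rewrite ?expr0 ?expr1 ?mul1r ?mulrNN ?mulr1.
have in_all v : in_dir 1 v /\ in_dir (-1) v ->
    forall w, in_dir 1 w /\ in_dir (-1) w.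
  move=> [v1 vN1] w; have [g <-] := vtrans v w; have [e eP] := psi_aut g.
  have := aut_in_dir eP v1; have := aut_in_dir eP vN1.
  by case: e {eP}; rewrite ?expr0 ?expr1 ?mul1r ?mulrNN ?mulr1.
apply: contrapT => /not_orP[nout nin].
have nout1 v : ~ (out_dir 1 v /\ out_dir (-1) v) by move=> /out_all.
have nin1 v : ~ (in_dir 1 v /\ in_dir (-1) v) by move=> /in_all.
have flow v : (out_dir 1 v /\ in_dir (-1) v) \/ (out_dir (-1) v /\ in_dir 1 v).
  have [w wv w1] := up_nbr v; have [u uv u1] := down_nbr v.
  have vout := nout1 v; have vin := nin1 v.
  case: wv => [vw|vw]; case: uv => [vu|vu].
  - by case: vout; split; [exists w|exists u].
  - by left; split; [exists w|exists u].
  - by right; split; [exists u|exists w].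
  - by case: vin; split; [exists w|exists u].
pose up_flow v := out_dir 1 v /\ in_dir (-1) v.
have up_flow_adj v w : adjacent v w -> up_flow v -> up_flow w.
  move=> vw [v1 vN1]; case: (flow w) => // -[wN1 w1].
  have vout := nout1 v; have vin := nin1 v.
  have wout := nout1 w; have win := nin1 w.
  case: (vw) => [vw'|wv']; case: (psi_adj vw) => E.
  - by case: win; split=> //; exists v => //; lia.
  - by case: vout; split=> //; exists w.
  - by case: vin; split=> //; exists w.
  - by case: wout; split=> //; exists v => //; lia.
have [[a [b [ab bE]]] [c [d [cd dE]]]] := arc_up_down.
have up_a : up_flow a.
  by case: (flow a) => // -[aN1 _]; case: (nout1 a); split=> //; exists b.
have : up_flow c.
  elim: (reach_sym (conn a c)) up_a => // x y z _ xy _ IH /IH.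
  exact/up_flow_adj/adjacent_sym.
by move=> [c1 _]; apply: (nout1 c); split=> //; exists d.
Qed.

(** By [branching], two arcs with the same tail or the same head [v] go to opposite levels; an
    automorphism carrying one to the other fixes [v] and must reflect. *)
Lemma stabilizer_reversing v : exists2 g : aut X, g v = v &
  forall x w, psi (g w) - psi (g x) = - (psi w - psi x).
Proof.
have key (g : aut X) w w' : g v = v -> g w = w' -> psi w = psi v + 1 ->
    psi w' = psi v + -1 -> exists2 g : aut X, g v = v &
    forall x w, psi (g w) - psi (g x) = - (psi w - psi x).
  move=> gv gw wE w'E; exists g => // x u; have [e eP] := psi_aut g.
  rewrite eP; have := eP v w; rewrite gv gw.
  by case: e {eP}; rewrite ?expr1 ?expr0 ?mulN1r //; lia.
case: branching => /(_ v)[[w vw wE] [w' vw' w'E]].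
  by have [g [gv gw]] := atrans vw vw'; exact: key gv gw wE w'E.
by have [g [gw gv]] := atrans vw vw'; exact: key gv gw wE w'E.
Qed.

Lemma dihedral_level_subgroup :
  let N := level_subgroup psi_aut in finite_orbits N /\ dihedral_case N.
Proof.
move=> N.
have Ntrans v w : psi v = psi w -> exists2 g, nsub_set N g & g v = w.
  move=> vw; have [g gv] := vtrans v w; have [[] eP] := psi_aut g; last first.
    exists g => // u; have := eP v u; rewrite gv expr0 mul1r; lia.
  (* If [g] reflects, a reflection fixing [w] corrects it to a level-preserving automorphism. *)
  have [h hw hP] := stabilizer_reversing w; exists (h * g)%g => [u /=|/=].
    by have := eP v u; have := hP (g v) (g u); rewrite gv hw expr1 mulN1r; lia.
  by rewrite gv.
split; first exact: level_finite_orbits.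
split.
  apply: quotient_level_iso => //; first exact: psi_surj.
  move=> i j; split=> [|[v [w [<- <- /psi_arc[]]]]]; last 2 first.
  - by left.
  - by move=> ->; right; rewrite subrK.
  (* Branching supplies arcs of both orientations between consecutive levels. *)
  have arcs k : (exists v w, [/\ psi v = k, psi w = k + 1 & arc v w]) /\
      (exists v w, [/\ psi v = k + 1, psi w = k & arc v w]).
    have [v vk] := psi_surj k; have [u uk] := psi_surj (k + 1).
    case: branching => br.
      have [[w vw wE] _] := br v; have [_ [w' uw w'E]] := br u.
      by split; [exists v, w|exists u, w']; split=> //; lia.
    have [_ [w vw wE]] := br u; have [[w' uw w'E] _] := br v.
    by split; [exists w, u|exists w', v]; split=> //; lia.
  by move=> [->|->]; [case: (arcs i)|case: (arcs j)].
have [o o0] := psi_surj 0; have [p p1] := psi_surj 1.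
have [e eP] := choice psi_aut.
(* The chosen sign [e g] is determined by the images of [o] and [p], on levels 0 and 1. *)
have eE (g : aut X) (b : bool) : psi (g p) - psi (g o) = (-1) ^+ b -> e g = b.
  by rewrite eP p1 o0 subr0 mulr1; case: (e g); case: b.
have affine (g : aut X) v : psi (g v) = psi (g o) + (-1) ^+ (e g) * psi v.
  by have := eP g o v; rewrite o0 subr0; lia.
apply: (@quotient_group_iso _ infinite_dihedral _ (fun g : aut X => (psi (g o), e g))).
- move=> g h.
  change ((psi (g (h o)), e (g * h)%g) =
    (psi (g o) + (-1) ^+ (e g) * psi (h o), e g (+) e h)).
  congr pair; first exact: affine.
  apply: eE; change (psi (g (h p)) - psi (g (h o)) = (-1) ^+ (e g (+) e h)).
  by rewrite eP eP p1 o0 subr0 mulr1 signr_addb.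
- move=> [m b]; have [v vm] := psi_surj m; have [g gv] := vtrans o v.
  have [eb|eb] := eqVneq (e g) b; first by exists g; rewrite gv vm eb.
  have [h hv hP] := stabilizer_reversing v; exists (h * g)%g => /=.
  rewrite gv hv vm; congr pair; apply: eE => /=; rewrite hP eP p1 o0 subr0 mulr1.
  by move: eb; case: (e g); case: b.
- move=> g; split=> [gN|[go eg] v].
    by rewrite gN o0; congr pair; apply: eE; rewrite !gN p1 o0 subr0.
  by rewrite affine go eg expr0 mul1r add0r.
Qed.

End Graded.

Lemma affine_onN (X : digraph) (psi : X -> int) :
  affine_on psi -> affine_on (fun v => - psi v).
Proof.
move=> psi_aut g; have [e eP] := psi_aut g; exists e => v w.
by rewrite -opprD eP -mulrN opprD.
Qed.

Lemma level_subgroup_exists (X : digraph) : vertex_transitive X ->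
  arc_transitive X -> two_ended X -> exists N : normalSubgroup (aut X),
  finite_orbits N /\ (dihedral_case N \/ cyclic_case N).
Proof.
move=> vtrans atrans ends2; have conn := connected_reach ends2.1.
have infX := two_ended_infinite ends2.
have [psi [psi_fin psi_aut psi_arc]] := grading_exists vtrans atrans ends2.
have [up|nup] := pselect (exists v w, arc v w /\ psi w = psi v + 1); last first.
  (* No arc rises, so all fall; negating the grading makes them all rise. *)
  pose npsi v := - psi v.
  have npsi_aut : affine_on npsi := affine_onN psi_aut.
  have npsi_up v w : arc v w -> npsi w = npsi v + 1.
    move=> vw; rewrite /npsi; case: (psi_arc v w vw) => E; last by lia.
    by case: nup; exists v, w.
  have npsi_fin m : finite_set [set w | npsi w = m].
    by apply: sub_finite_set (psi_fin (- m)) => w /= <-; rewrite opprK.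
  exists (level_subgroup npsi_aut).
  have [] := @cyclic_level_subgroup _ _ npsi_fin npsi_aut _ vtrans conn infX npsi_up.
    by move=> v w /npsi_up; left.
  by split=> //; right.
exists (level_subgroup psi_aut).
have [down|ndown] := pselect (exists v w, arc v w /\ psi w = psi v - 1).
  have [] := @dihedral_level_subgroup _ _ psi_fin psi_aut psi_arc vtrans atrans
    conn infX (conj up down).
  by split=> //; left.
have psi_up v w : arc v w -> psi w = psi v + 1.
  by move=> vw; case: (psi_arc v w vw) => // E; case: ndown; exists v, w.
have [] := @cyclic_level_subgroup _ _ psi_fin psi_aut psi_arc vtrans conn infX psi_up.
by split=> //; right.
Qed.


(** * The action on the ends *)

(** Injectivity forbids turning back, so the direction of the step from 0 to 1 persists both
    ways. *)
Lemma int_unit_steps (h : int -> int) : injective h ->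
  (forall i : int, h (i + 1) = h i + 1 \/ h (i + 1) = h i - 1) ->
  exists e : bool, forall i, h i = h 0 + (-1) ^+ e * i.
Proof.
move=> hinj hstep.
have [e he] : exists e : bool, h 1 = h 0 + (-1) ^+ e.
  by have := hstep 0; rewrite add0r => -[->|->]; [exists false|exists true].
have [d dE d1] : exists2 d : int, (-1) ^+ e = d & d = 1 \/ d = - 1.
  by exists ((-1) ^+ e) => //; case: (e); [right|left].
rewrite dE in he.
have fold i : h i <> h (i + 1 + 1) by move=> /hinj; lia.
have up n : h (n%:Z + 1) = h n%:Z + d.
  elim: n => [|n IH]; first by rewrite add0r he.
  have -> : n.+1%:Z = n%:Z + 1 by lia.
  by have := fold n%:Z; have := hstep (n%:Z + 1); lia.
have down n : h (- n%:Z + 1) = h (- n%:Z) + d.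
  elim: n => [|n IH]; first by rewrite oppr0 add0r he.
  have [k kE] : exists k : int, k = - n.+1%:Z by exists (- n.+1%:Z).
  have nE : - n%:Z = k + 1 by lia.
  rewrite -kE; move: IH; rewrite nE.
  move: (fold k) (hstep k); move: (h (k + 1 + 1)) (h (k + 1)) (h k) => x y z.
  by case: d1 => ->; lia.
exists e => i; rewrite dE.
have upn n : h n%:Z = h 0 + d * n%:Z.
  elim: n => [|n IH]; first by rewrite mulr0 addr0.
  have -> : n.+1%:Z = n%:Z + 1 by lia.
  by rewrite up IH; ring.
have downn n : h (- n%:Z) = h 0 - d * n%:Z.
  elim: n => [|n IH]; first by rewrite oppr0 mulr0 subr0.
  have := down n.+1; have -> : - n.+1%:Z + 1 = - n%:Z by lia.
  by rewrite IH => /eqP; rewrite eq_sym -subr_eq => /eqP <-; rewrite -addn1 PoszD; ring.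
have [i0|i0] := lerP 0 i; first by rewrite -(gez0_abs i0).
by rewrite (_ : i = - `|i|%N%:Z); [rewrite downn mulrN|lia].
Qed.

Section EndAction.
Variable X : digraph.

Lemma end_action_end_of (g : aut X) (t : nat -> X) :
  end_action g (end_of t) = end_of (g \o t).
Proof.
apply/seteqP; split=> u.
  move=> [u' [ru' /ray_equivP tu'] <-]; split; first exact: aut_ray.
  exact/ray_equivP/aut_eqv.
move=> [ru /ray_equivP gtu]; exists ((g^-1)%g \o u); last first.
  by apply/funext => n /=; rewrite autKV.
split; first exact: aut_ray.
apply/ray_equivP/(aut_eqvV (g := g)); move: gtu; congr eqv.
by apply/funext => n /=; rewrite autKV.
Qed.

Variable psi : X -> int.
Hypothesis ends2 : two_ended X.
Hypothesis psi_fin : forall m, finite_set [set w | psi w = m].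
Hypothesis psi_arc : forall v w, arc v w -> psi w = psi v + 1 \/ psi w = psi v - 1.
Hypothesis psi_up : forall v, exists w, adjacent v w /\ psi w = psi v + 1.
Hypothesis psi_down : forall v, exists w, adjacent v w /\ psi w = psi v - 1.

(** A half-space with finite boundary, inside level -1; it tells the two ends apart. *)
Let upper : set X := [set v | 0 <= psi v].

Lemma finite_bdry_upper : finite_set (bdry upper).
Proof.
apply: sub_finite_set (psi_fin (-1)) => y [nUy [x Ux xy]] /=.
move: nUy Ux; rewrite /upper /= => /negP; rewrite -ltNge.
by case: xy => /psi_arc[]; lia.
Qed.

Lemma ray_leaves_band t n : is_ray t ->
  eventually_in t [set v | n%:Z < `|psi v|].
Proof.
move=> tr; have fin : finite_set [set v | `|psi v| <= n%:Z].
  elim: n => [|n IH].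
    by apply: sub_finite_set (psi_fin 0) => v /=; lia.
  apply: (@sub_finite_set _ _ ([set v | `|psi v| <= n%:Z] `|`
    ([set v | psi v = n.+1%:Z] `|` [set v | psi v = - n.+1%:Z]))).
    move=> v /= vn; case: (lerP `|psi v| n%:Z) => [|nv]; first by left.
    by right; case: (lerP 0 (psi v)) => v0; [left|right] => /=; lia.
  by rewrite !finite_setU.
by apply: eventually_inS (ray_avoids tr fin) => v /= /negP; rewrite -ltNge.
Qed.

Lemma monotone_ray (d : int) : d = 1 \/ d = -1 ->
  exists t, is_ray t /\ forall n, psi (t n) = d * n%:Z + psi (t 0%N).
Proof.
move=> d1; have [r [_ [_ _ _ _]]] := two_ended_rays ends2.
have /choice[f fP] : forall v, exists w, adjacent v w /\ psi w = psi v + d.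
  by case: d1 => ->; [exact: psi_up|exact: psi_down].
have [t tS] : exists t : nat -> X, forall n, t n.+1 = f (t n).
  by exists (fun n => iter n f (r 0%N)).
have tE n : psi (t n) = d * n%:Z + psi (t 0%N).
  elim: n => [|n IH]; first by rewrite mulr0 add0r.
  have [_ fE] := fP (t n); rewrite tS fE IH -addn1 PoszD mulrDr mulr1.
  by rewrite addrAC.
exists t; split=> //; split=> [i j /(congr1 psi)|i];
  last by rewrite tS; case: (fP (t i)).
by rewrite (tE i) (tE j) => /addIr; case: d1 => -> ; lia.
Qed.

(** An ascending ray [p] and a descending ray [m] lie on different sides, so they represent the two
    ends, and the side of a ray determines its end. *)
Lemma same_side_eqv t u : is_ray t -> is_ray u ->
  (eventually_in t upper <-> eventually_in u upper) -> eqv t u.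
Proof.
move=> tr ur tu.
have [r [s [rr sr nrs ends_rs]]] := two_ended_rays ends2.
have [p [pr pE]] := monotone_ray (or_introl (erefl 1)).
have [m [mr mE]] := monotone_ray (or_intror (erefl (-1))).
have p_up : eventually_in p upper.
  by exists `|psi (p 0%N)|%N => n; rewrite /upper /= (pE n); lia.
have m_up : ~ eventually_in m upper.
  move=> [n /(_ (n + `|psi (m 0%N)|.+1)%N (leq_addr _ _))].
  by rewrite /upper /= (mE (n + _)%N); lia.
have side a b : is_ray a -> is_ray b -> eqv a b ->
    eventually_in a upper -> eventually_in b upper.
  by move=> ra rb ab; exact: eqv_side rb ab finite_bdry_upper.
have npm : ~ eqv p m by move=> /(side _ _ pr mr)/(_ p_up).
have ends_pm a : is_ray a -> eqv a p \/ eqv a m.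
  by move=> ra; case: (ends_rs a ra); case: (ends_rs p pr); case: (ends_rs m mr)
    => em ep ea; first [case: npm; exact: (eqv_trans _ ep (eqv_sym em))
      |left; exact: (eqv_trans _ ea (eqv_sym ep))
      |right; exact: (eqv_trans _ ea (eqv_sym em))].
case: (ends_pm t tr) => et; case: (ends_pm u ur) => eu.
- exact: eqv_trans pr et (eqv_sym eu).
- case: m_up; apply: (side _ _ ur mr eu); apply/tu.
  exact: side pr tr (eqv_sym et) p_up.
- case: m_up; apply: (side _ _ tr mr et); apply/tu.
  exact: side pr ur (eqv_sym eu) p_up.
- exact: eqv_trans mr et (eqv_sym eu).
Qed.

(** A translation by [b] changes the sign of a level only within the band of width [|b|], which the
    ray eventually leaves. *)
Lemma translation_side (g : aut X) t : is_ray t ->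
  (forall v w, psi (g w) - psi (g v) = psi w - psi v) ->
  eventually_in (g \o t) upper <-> eventually_in t upper.
Proof.
move=> tr gP; pose b := psi (g (t 0%N)) - psi (t 0%N).
have gE v : psi (g v) = psi v + b by have := gP (t 0%N) v; rewrite /b; lia.
have far := ray_leaves_band `|b|%N tr.
change (eventually_in t (g @^-1` upper) <-> eventually_in t upper).
by split=> /(eventually_inI far); apply: eventually_inS => v;
  rewrite /upper /= ?gE => -[]; lia.
Qed.

Lemma reflection_side (g : aut X) t : is_ray t ->
  (forall v w, psi (g w) - psi (g v) = - (psi w - psi v)) ->
  eventually_in (g \o t) upper <-> ~ eventually_in t upper.
Proof.
move=> tr gP; pose b := psi (g (t 0%N)) + psi (t 0%N).
have gE v : psi (g v) = b - psi v by have := gP (t 0%N) v; rewrite /b; lia.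
have far := ray_leaves_band `|b|%N tr.
change (eventually_in t (g @^-1` upper) <-> ~ eventually_in t upper).
split=> [gt ut|nut].
  have [n /(_ n (leqnn n))] := eventually_inI far (eventually_inI gt ut).
  by rewrite /upper /= gE => -[+ []]; lia.
case: (ray_side tr finite_bdry_upper) => // /(eventually_inI far).
apply: eventually_inS => v [/= + nv].
have : ~ upper v by move=> uv; apply: nv; left.
by rewrite /upper /= gE; lia.
Qed.

Lemma translations_trivial_on_ends :
  (forall (g : aut X) v w, psi (g w) - psi (g v) = psi w - psi v) ->
  trivial_on_ends X.
Proof.
move=> gP g e [t tr <-]; rewrite end_action_end_of; apply/end_of_eqv => //.
  exact: aut_ray.
by apply: same_side_eqv => //; [exact: aut_ray|exact: translation_side].
Qed.

Lemma reflection_transitive_on_ends (g : aut X) :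
  (forall v w, psi (g w) - psi (g v) = - (psi w - psi v)) ->
  transitive_on_ends X.
Proof.
move=> gP e e' [t tr <-] [u ur <-].
have [tu|ntu] := pselect (eventually_in t upper <-> eventually_in u upper).
  by exists 1%g; rewrite end_action_end_of; apply/end_of_eqv => //; apply: same_side_eqv.
exists g; rewrite end_action_end_of; have gtr := aut_ray g tr.
apply/end_of_eqv => //; apply: same_side_eqv => //.
rewrite (reflection_side tr gP).
by have := EM (eventually_in t upper); have := EM (eventually_in u upper); tauto.
Qed.

End EndAction.


(** * Gradings recovered from a given quotient *)

Section BlockGrading.
Variables (X : digraph) (N : normalSubgroup (aut X)).

Lemma orbit_trans_sym v w z : orbit N v z -> orbit N w z -> orbit N v w.
Proof.
move=> [g Ng gv] [h Nh hw]; exists (h^-1 * g)%g.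
  by apply: nsubM => //; exact: nsubV.
by rewrite -[LHS]/((h^-1)%g (g v)) gv -hw autK.
Qed.

Lemma orbit_refl v : orbit N v v.
Proof. by exists 1%g => //; exact: nsub1. Qed.

Lemma orbit_sym v w : orbit N v w -> orbit N w v.
Proof. by move=> vw; apply: orbit_trans_sym vw; exact: orbit_refl. Qed.

Lemma aut_orbit (g : aut X) v w : orbit N v w -> orbit N (g v) (g w).
Proof.
move=> [n Nn <-]; exists (n ^ (g^-1))%g; first exact: nsub_normal.
by rewrite -[LHS]/(((g^-1)^-1)%g (n ((g^-1)%g (g v)))) autK invgK.
Qed.

(** The consequences concern every admissible [N], so a grading is rebuilt from the quotient
    isomorphism alone. Arcs of the quotient lift to arcs at any prescribed vertex because [N] is
    transitive on each block. *)
Lemma quotient_grading (R : int -> int -> Prop) : finite_orbits N ->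
  digraph_isomorphic (quotient_digraph N) (@Digraph int R) ->
  exists psi : X -> int,
  [/\ forall m, finite_set [set w | psi w = m], forall i, exists v, psi v = i,
      forall v w, arc v w -> R (psi v) (psi w),
      (forall v j, R (psi v) j -> exists w, arc v w /\ psi w = j) /\
      (forall v i, R i (psi v) -> exists u, arc u v /\ psi u = i) &
      forall (g : aut X) v w, psi v = psi w -> psi (g v) = psi (g w)].
Proof.
move=> Nfin [f [fbij farc]].
pose block v : quotient_digraph N := SigSub (mem_set (imageT (orbit N) v)).
pose psi v : int := f (block v).
have level v w : psi v = psi w <-> orbit N v w.
  split=> [/(bij_inj fbij)/(congr1 val) /= vw|vw].
    by rewrite vw; exact: orbit_refl.
  congr f; apply: val_inj => /=; apply/seteqP; split=> z.
    by move=> /orbit_sym zv; apply/orbit_sym/(orbit_trans_sym zv)/orbit_sym.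
  by move=> /orbit_sym zw; apply/orbit_sym/(orbit_trans_sym zw).
have surj i : exists v, psi v = i.
  have [f' f'K fK] := fbij; have [v _ vE] := set_mem (valP (f' i)).
  exists v; rewrite -[RHS]fK; congr f; exact: val_inj.
exists psi; split=> //.
- move=> m; have [v <-] := surj m; apply: sub_finite_set (Nfin v) => w /= wv.
  exact/level.
- move=> v w vw; apply/(farc (block v) (block w)); exists v, w.
  by split=> //; exact: orbit_refl.
- split=> v j; have [w <-] := surj j.
    move=> /(farc (block v) (block w))[v' [w' [/= vv' ww' vw']]].
    have [g Ng gv'] := orbit_sym vv'.
    exists (g w'); split; first by rewrite -gv'; apply/aut_arc.
    apply/level; apply: orbit_sym; apply: (orbit_trans_sym ww').
    by apply: orbit_sym; exists g.
  move=> /(farc (block w) (block v))[w' [v' [/= ww' vv' wv']]].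
  have [g Ng gv'] := orbit_sym vv'.
  exists (g w'); split; first by rewrite -gv'; apply/aut_arc.
  apply/level; apply: orbit_sym; apply: (orbit_trans_sym ww').
  by apply: orbit_sym; exists g.
- by move=> g v w /level vw; apply/level; exact: aut_orbit.
Qed.

End BlockGrading.

Lemma cyclic_property_Z (X : digraph) (N : normalSubgroup (aut X)) :
  two_ended X -> finite_orbits N -> cyclic_case N -> property_Z X.
Proof.
move=> [Xconn _] Nfin [/(quotient_grading Nfin)[psi [_ surj arcR _ _]] _].
split=> //; exists psi; split=> //; apply/seteqP; split=> // i _.
by have [v vi] := surj i; exists v.
Qed.

(** An arc and its image both rise by one, so along walks every automorphism acts as a
    translation. *)
Lemma cyclic_trivial_on_ends (X : digraph) (N : normalSubgroup (aut X)) :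
  two_ended X -> finite_orbits N -> cyclic_case N -> trivial_on_ends X.
Proof.
move=> ends2 Nfin [/(quotient_grading Nfin)[psi [fin surj arcR [out inn] _]] _].
have conn := connected_reach ends2.1.
apply: (@translations_trivial_on_ends X psi) => //.
- by move=> v w /arcR; left.
- by move=> v; have [w [vw wE]] := out v _ erefl; exists w; split=> //; left.
- move=> v; have [|u [uv uE]] := inn v (psi v - 1); first by rewrite subrK.
  by exists u; split=> //; right.
- move=> g v w; elim: (conn v w) => [x _|x y z _ xy _ IH]; first by rewrite !subrr.
  have : psi (g y) - psi (g x) = psi y - psi x.
    by case: xy => xy; have := arcR _ _ xy;
      have := arcR _ _ (iffRL (aut_arc g _ _) xy); lia.
  lia.
Qed.

(* A directed walk alternating between two adjacent finite levels would map
   injectively along Z. *)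
Lemma dihedral_not_property_Z (X : digraph) (N : normalSubgroup (aut X)) :
  finite_orbits N -> dihedral_case N -> ~ property_Z X.
Proof.
move=> Nfin [/(quotient_grading Nfin)[psi [fin surj arcR [out _] _]] _].
move=> [_ [f [fhom _]]].
have [v0 v00] := surj 0; pose B := [set v | psi v = 0] `|` [set v | psi v = 1].
have /choice[p pP] : forall v, exists w, B v -> arc v w /\ B w.
  move=> v; have [Bv|] := pselect (B v); last by exists v0.
  (* The target level [1 - psi v] exchanges levels 0 and 1. *)
  have [|w [vw wE]] := out v (1 - psi v).
    by case: Bv => /= ->; [left|right]; lia.
  exists w => _; split=> //; case: Bv => /= vE; rewrite vE in wE.
    by right; rewrite /= wE; lia.
  by left; rewrite /= wE; lia.
have iterB n : B (iter n p v0).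
  by elim: n => [|n IH]; [left|exact: (pP _ IH).2].
have fE n : f (iter n p v0) = f v0 + n%:Z.
  elim: n => [|n IH]; first by rewrite addr0.
  by rewrite /= (fhom _ _ (pP _ (iterB n)).1) IH -addrA -PoszD addn1.
have finB : finite_set B by rewrite finite_setU.
have iter_inj : injective (fun n => iter n p v0).
  by move=> i j /(congr1 f); rewrite !fE => /addrI[].
by have [n /(_ n (leqnn n))] := injective_avoids_finite iter_inj finB; apply.
Qed.

(** Some 2-arcs visit levels 0, 1, 0 and others 0, 1, 2; automorphisms permute the levels and cannot
    carry the first kind to the second. *)
Lemma dihedral_not_two_arc_transitive (X : digraph) (N : normalSubgroup (aut X)) :
  finite_orbits N -> dihedral_case N -> ~ two_arc_transitive X.
Proof.
move=> Nfin [/(quotient_grading Nfin)[psi [_ surj _ [out _] autP]] _] trans.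
have [v0 v00] := surj 0.
have [|v1 [v01 v1E]] := out v0 1; first by rewrite v00; left.
have [|v2 [v12 v2E]] := out v1 2; first by rewrite v1E; left.
have [|u2 [v1u2 u2E]] := out v1 0; first by rewrite v1E; right.
have [g [gv0 _ gu2]] := trans _ _ _ _ _ _ v01 v1u2 v01 v12.
by have := autP g v0 u2; rewrite v00 u2E gv0 gu2 v00 v2E => /(_ erefl).
Qed.

(** For a given [N] the grading is not yet known to be affine: the map [h] induced on levels is
    injective with unit steps, hence an isometry. *)
Lemma dihedral_transitive_on_ends (X : digraph) (N : normalSubgroup (aut X)) :
  arc_transitive X -> two_ended X -> finite_orbits N -> dihedral_case N ->
  transitive_on_ends X.
Proof.
move=> atrans ends2 Nfin.
move=> [/(quotient_grading Nfin)[psi [fin surj arcR [out _] autP]] _].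
have psi_arc v w : arc v w -> psi w = psi v + 1 \/ psi w = psi v - 1.
  by move=> /arcR[]; lia.
have up v : exists w, adjacent v w /\ psi w = psi v + 1.
  by have [|w [vw wE]] := out v (psi v + 1); [left|exists w; split=> //; left].
have down v : exists w, adjacent v w /\ psi w = psi v - 1.
  by have [|w [vw wE]] := out v (psi v - 1);
    [right; rewrite subrK|exists w; split=> //; left].
have [v0 v00] := surj 0.
have [|v1 [v01 v1E]] := out v0 1; first by rewrite v00; left.
have [|u0 [v1u0 u0E]] := out v1 0; first by rewrite v1E; right.
(* [g] carries an arc rising from level 0 to 1 to one falling from 1 to 0, so it must be a
   reflection. *)
have [g [gv0 gv1]] := atrans _ _ _ _ v01 v1u0.
apply: (@reflection_transitive_on_ends X psi ends2 fin psi_arc up down g).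
have [lift liftE] := choice surj.
pose h i := psi (g (lift i)).
have hE v : psi (g v) = h (psi v) by apply: autP; rewrite liftE.
have hinj : injective h.
  move=> i j /(autP (g^-1)%g); rewrite !autK !liftE; exact.
have hstep (i : int) : h (i + 1) = h i + 1 \/ h (i + 1) = h i - 1.
  have [w [vw wE]] := up (lift i); rewrite liftE in wE.
  rewrite -wE -hE /h.
  by case: vw => /(aut_arc g)/psi_arc[]; [left|right|right|left]; lia.
have [e he] := int_unit_steps hinj hstep.
have e1 : (-1) ^+ e = - 1 :> int.
  have := he 1; rewrite mulr1 -v1E -hE -[X in h X]v00 -hE gv0 gv1 v1E u0E; lia.
by move=> v w; rewrite !hE !(he (psi _)) e1; lia.
Qed.

Theorem lemma7 (Gamma : digraph) (vtrans : vertex_transitive Gamma)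
    (atrans : arc_transitive Gamma) (ends2 : two_ended Gamma) :
  (exists N : normalSubgroup (aut Gamma),
      finite_orbits N /\ (dihedral_case N \/ cyclic_case N)) /\
  (forall N : normalSubgroup (aut Gamma),
      finite_orbits N -> dihedral_case N \/ cyclic_case N ->
      [/\ cyclic_case N -> property_Z Gamma,
          dihedral_case N -> ~ property_Z Gamma,
          two_arc_transitive Gamma -> cyclic_case N,
          dihedral_case N -> transitive_on_ends Gamma
        & cyclic_case N -> trivial_on_ends Gamma]).
Proof.
split=> [|N Nfin Ncase]; first exact: level_subgroup_exists.
split.
- exact: cyclic_property_Z.
- exact: dihedral_not_property_Z.
- by case: Ncase => // /(dihedral_not_two_arc_transitive Nfin).
- exact: dihedral_transitive_on_ends.
- exact: cyclic_trivial_on_ends.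
Qed.
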